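(* Let $\Gamma$ and $\Delta$ be countable groups and $(X,\mu)$ a standard probability space. Suppose there are free measure preserving Borel actions $\Delta \curvearrowright^{a_0} (X,\mu)$ and $\Gamma \curvearrowright^{b_0} (X,\mu)$ such that $b_0$ is ergodic and $E^{a_0}_{\Delta}\subseteq E^{b_0}_{\Gamma}$. Let $\Delta\curvearrowright^{a}(Z,\nu)$ be a measure preserving Borel action on a standard probability space $(Z,\nu)$. Then there exist a standard probability space $(Y,m)$, Borel actions $\Gamma\curvearrowright^{c}(Y,m)$ and $\Delta\curvearrowright^{d}(Y,m)$ and a Borel map $p:Y\to Z$ such that: (1) $c$ is free and measure preserving; (2) $d$ is free and measure preserving; (3) $p$ is measure preserving, i.e. $p_*m=\nu$; (4) $E^d_\Delta\subseteq E^c_\Gamma$; (5) $p$ witnesses that $a\sqsubseteq d$, i.e. $p(\gamma^d\cdot y)=\gamma^a\cdot p(y)$ for all $\gamma\in\Delta$ and $y\in Y$. Moreover, if $a$ is ergodic, then $c$ can be chosen to be ergodic as well.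
   Context: For a Borel action $e$ of a countable group $G$ on $X$, $E^e_G=\{(x,\gamma^e\cdot x): x\in X,\gamma\in G\}$ is its orbit equivalence relation. For measure preserving actions $a$ of $G$ on $(X,\mu)$ and $b$ on $(Y,\nu)$, $b\sqsubseteq a$ ($b$ is a factor of $a$) means there is a Borel measure preserving map $p:X\to Y$ with $p(\gamma^a\cdot x)=\gamma^b\cdot p(x)$ for all $\gamma\in G$, $x\in X$. *)

(* Defs.v *)
From HB Require Import structures.
From mathcomp Require Import all_boot all_order all_algebra.
From mathcomp Require Import monoid.
From mathcomp Require Import all_classical all_reals all_analysis.
Set Implicit Arguments. Unset Strict Implicit. Unset Printing Implicit Defensive.
Import Order.TTheory GRing.Theory Num.Theory.
Local Open Scope classical_set_scope.
Local Open Scope ring_scope.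

Section Standard.
Variables (R : realType).

Definition metric_open (T : Type) (dist : T -> T -> R) (U : set T) : Prop :=
  forall x, U x -> exists2 r : R, 0 < r & forall y, dist x y < r -> U y.

Definition polish_metric (T : Type) (dist : T -> T -> R) : Prop :=
  [/\ (forall x y, 0 <= dist x y) /\
      (forall x y, dist x y = 0 <-> x = y),
      (forall x y, dist x y = dist y x),
      (forall x y z, dist x z <= dist x y + dist y z),
      (forall u : nat -> T,
         (forall e : R, 0 < e -> exists N, forall n m, (N <= n)%N -> (N <= m)%N ->
              dist (u n) (u m) < e) ->
         exists x, forall e : R, 0 < e -> exists N, forall n, (N <= n)%N ->
              dist (u n) x < e) &
      (exists D : nat -> T, forall x (e : R), 0 < e -> exists n, dist x (D n) < e)].

Definition standard_borel (d : measure_display) (T : measurableType d) : Prop :=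
  exists dist : T -> T -> R, polish_metric dist /\
    forall A : set T, measurable A <-> <<s metric_open dist >> A.

End Standard.

Section Actions.
Variables (R : realType) (G : groupType).
Local Open Scope group_scope.

Definition is_action (X : Type) (act : G -> X -> X) : Prop :=
  (forall x, act 1 x = x) /\ (forall g h x, act (g * h) x = act g (act h x)).

Definition borel_action (d : measure_display) (X : measurableType d)
  (act : G -> X -> X) : Prop :=
  is_action act /\ forall g, measurable_fun setT (act g).

Definition mp_action (d : measure_display) (X : measurableType d)
  (mu : probability X R) (act : G -> X -> X) : Prop :=
  forall g (A : set X), measurable A -> mu (act g @^-1` A) = mu A.

Definition free_action (X : Type) (act : G -> X -> X) : Prop :=
  forall g x, act g x = x -> g = 1.

Definition ergodic_action (d : measure_display) (X : measurableType d)
  (mu : probability X R) (act : G -> X -> X) : Prop :=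
  forall A : set X, measurable A -> (forall g, act g @^-1` A = A) ->
    mu A = 0%E \/ mu A = 1%E.

Definition orbit_rel (X : Type) (act : G -> X -> X) (x y : X) : Prop :=
  exists g, y = act g x.

End Actions.

Definition rel_sub (X : Type) (E F : X -> X -> Prop) : Prop :=
  forall x y, E x y -> F x y.

Definition countable_group (G : groupType) : Prop := countable [set: G].

Definition mp_map (R : realType) (d1 d2 : measure_display)
  (Y : measurableType d1) (Z : measurableType d2)
  (m : probability Y R) (nu : probability Z R) (p : Y -> Z) : Prop :=
  measurable_fun setT p /\ forall A : set Z, measurable A -> m (p @^-1` A) = nu A.

(* Main.v *)
(* The space is Y = X * Z^N with measure mu * nu^N. A point (x, f) encodes a
   Delta-equivariant map from the Gamma-orbit of x to Z: every Delta-class in that orbit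
   is numbered through its first element in a fixed enumeration of Gamma, and f n is the
   value of the map at that first element of the n-th class. Gamma acts by moving the
   base point, Delta acts inside the Gamma-orbits as a0 prescribes, and p evaluates the
   map at the base point. Changing the base point permutes the coordinates and applies
   elements of Delta to them, so the product measure is preserved.
   If a is ergodic, the product measure is replaced by an ergodic component: the
   components push forward to a-invariant measures whose barycenter is the extreme point
   nu, so almost all of them push forward to nu. The ergodic decomposition is obtained
   by hand: the mean ergodic theorem gives the invariant conditional expectations of
   cylinder sets in a Cantor coding of Y, and these weights define a probability measure
   as the image of Lebesgue measure under an interval-splitting map. *)

Require Import Defs.
From HB Require Import structures.
From mathcomp Require Import all_boot all_order all_algebra.
From mathcomp Require Import monoid.
From mathcomp Require Import all_classical all_reals all_analysis.
From mathcomp Require Import ring lra measurable_realfun.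
Set Implicit Arguments.
Unset Strict Implicit.
Unset Printing Implicit Defensive.
Import Order.TTheory GRing.Theory Num.Theory.
Import numFieldNormedType.Exports.
Local Open Scope classical_set_scope.
Local Open Scope ring_scope.

#[local] Hint Extern 0 (is_true (countable _)) => exact: countableP : core.

(** * Discrete measurability and Cantor codings *)

(** [Delta] is not a subgroup of [Gamma], so there is no coset space over which to co-induce: the
    set of [Delta]-classes in a [Gamma]-orbit, seen from a base point, varies with that point. The
    numbering supplies the common index set [nat], hence one product measure for all fibres, and it
    is Borel because leaders are chosen by least index. Freeness of [a0] makes the element of
    [Delta] between two points of a class unique; freeness of [b0] does the same for the element of
    [Gamma] that realizes a move of [Delta]. Freeness, the inclusion of orbits and equivariance of
    [p] hold at every point, so they survive a change of measure. After passing to an ergodic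
    component only invariance and the image under [p] are at stake. Invariance under [d] follows
    from invariance under [c], because [d] moves points inside [c]-orbits; for the same reason
    components of the [Gamma]-action have [Delta]-invariant images. Standardness is used in two
    forms: a Polish metric, to be exhibited on the product, and a Borel retraction from Cantor
    space, which reduces statements about measures to countably many cylinders, so that exceptional
    null sets can be united. *)

Lemma measurable_preimage d d' (X : measurableType d) (Y : measurableType d')
  (f : X -> Y) (A : set Y) :
  measurable_fun setT f -> measurable A -> measurable (f @^-1` A).
Proof. by move=> mf mA; rewrite -[X in measurable X]setTI; exact: mf. Qed.

Section DiscreteMeasurability.
Context d (X : measurableType d).

Lemma measurable_exists (I : Type) (P : I -> X -> Prop) :
  countable [set: I] -> (forall i, measurable [set x | P i x]) ->
  measurable [set x | exists i, P i x].
Proof.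
move=> cI mP; rewrite (_ : mkset _ = \bigcup_i [set x | P i x]).
  exact: countable_bigcupT_measurable.
by apply/seteqP; split=> x [i]; exists i.
Qed.

Lemma measurable_forall (I : Type) (P : I -> X -> Prop) :
  countable [set: I] -> (forall i, measurable [set x | P i x]) ->
  measurable [set x | forall i, P i x].
Proof.
move=> cI mP; rewrite (_ : mkset _ = ~` [set x | exists i, ~ P i x]).
  apply/measurableC/measurable_exists => // i; exact: (measurableC (mP i)).
apply/seteqP; split=> x /=; first by move=> h [i]; apply.
by move=> h i; apply: contrapT => ?; apply: h; exists i.
Qed.

Lemma measurable_imply (P Q : X -> Prop) :
  measurable [set x | P x] -> measurable [set x | Q x] ->
  measurable [set x | P x -> Q x].
Proof.
move=> mP mQ; rewrite (_ : mkset _ = ~` [set x | P x] `|` [set x | Q x]).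
  by apply: measurableU => //; apply: measurableC.
apply/seteqP; split=> x /=; last by case.
by move=> PQ; case: (pselect (P x)) => [/PQ|]; [right|left].
Qed.

(** Measurability into a discrete codomain. It applies to values in a bare countable type, such as
    an abstract group, that carries no sigma-algebra. *)
Definition dmeas (V : Type) (u : X -> V) : Prop :=
  forall A : set V, measurable (u @^-1` A).

Lemma dmeas_fibers (V : Type) (u : X -> V) : countable [set: V] ->
  (forall v, measurable [set x | u x = v]) -> dmeas u.
Proof.
move=> cV mu A.
rewrite (_ : _ @^-1` _ = [set x | exists v, u x = v /\ A v]).
  apply: measurable_exists => // v; case: (pselect (A v)) => Av.
    by rewrite (_ : mkset _ = [set x | u x = v]) //; apply/seteqP; split=> x /=; case.
  by rewrite (_ : mkset _ = set0) //; apply/seteqP; split=> x //=; case.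
by apply/seteqP; split=> [x Ax|x [v [<-]]] //; exists (u x).
Qed.

(** The tool for definitions whose parameters depend on the point: with a countable-valued parameter
    it is enough to treat each fixed value. *)
Lemma dmeas_bind (V I : Type) (u : I -> X -> V) (s : X -> I) :
  countable [set: I] -> dmeas s -> (forall i, dmeas (u i)) ->
  dmeas (fun x => u (s x) x).
Proof.
move=> cI ms mu A.
rewrite (_ : _ @^-1` _ = [set x | exists i, s x = i /\ A (u i x)]).
  apply: measurable_exists => // i; apply: measurableI; last exact: mu.
  exact: (ms [set i]).
by apply/seteqP; split=> [x Ax|x [v [<-]]] //; exists (s x).
Qed.

Lemma dmeas_comp (V W : Type) (h : V -> W) (u : X -> V) :
  dmeas u -> dmeas (fun x => h (u x)).
Proof. by move=> mu A; apply: (mu (h @^-1` A)). Qed.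

Lemma dmeas_cst (V : Type) (v : V) : dmeas (fun=> v).
Proof.
move=> A; case: (pselect (A v)) => Av.
  by rewrite (_ : _ @^-1` _ = setT) //; apply/seteqP; split.
by rewrite (_ : _ @^-1` _ = set0) //; apply/seteqP; split.
Qed.

Lemma measurable_const (P : Prop) : measurable [set x : X | P].
Proof. exact: (dmeas_cst P (fun Q => Q)). Qed.

Lemma dmeas_bool (P : X -> Prop) :
  measurable [set x | P x] -> dmeas (fun x => `[<P x>]).
Proof.
move=> mP; apply: dmeas_fibers; [exact: countableP|case].
  by rewrite (_ : mkset _ = [set x | P x]) //; apply/seteqP; split=> x /=;
    case: asboolP.
rewrite (_ : mkset _ = ~` [set x | P x]); first exact: measurableC.
by apply/seteqP; split=> x /=; case: asboolP.
Qed.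

Lemma measurable_bind d' (T : measurableType d') (I : Type)
  (u : I -> X -> T) (s : X -> I) :
  countable [set: I] -> dmeas s -> (forall i, measurable_fun setT (u i)) ->
  measurable_fun setT (fun x => u (s x) x).
Proof.
move=> cI ms mu _ A mA; rewrite setTI.
rewrite (_ : _ @^-1` _ = [set x | exists i, s x = i /\ A (u i x)]).
  apply: measurable_exists => // i; apply: measurableI.
    exact: (ms [set i]).
  exact: (measurable_preimage (mu i)).
by apply/seteqP; split=> [x Ax|x [v [<-]]] //; exists (s x).
Qed.

End DiscreteMeasurability.

Lemma dmeas_precomp d d' (X : measurableType d) (Y : measurableType d')
  (V : Type) (u : Y -> V) (f : X -> Y) :
  measurable_fun setT f -> dmeas u -> dmeas (fun x => u (f x)).
Proof. by move=> mf mu A; apply: (measurable_preimage mf (mu A)). Qed.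

(** Selecting the least witness, instead of an arbitrary one, keeps every later choice measurable
    ([dmeas_least]). *)
Definition least (P : nat -> Prop) : option nat :=
  if pselect (exists n, `[<P n>]) is left h then Some (ex_minn h) else None.

Lemma leastP (P : nat -> Prop) n :
  least P = Some n <-> P n /\ forall k, (k < n)%N -> ~ P k.
Proof.
rewrite /least; case: pselect => [h|h]; last first.
  by split=> // -[Pn _]; case: h; exists n; apply/asboolP.
case: ex_minnP => m /asboolP Pm minm; split=> [[<-]|[Pn minn]].
  split=> // k km Pk; have /minm : `[<P k>] by apply/asboolP.
  by rewrite leqNgt km.
suff -> : m = n by [].
have mn : (m <= n)%N by apply: minm; apply/asboolP.
apply/eqP; rewrite eqn_leq mn /= leqNgt; apply/negP => nm.
exact: minn Pm.
Qed.

Lemma leastN (P : nat -> Prop) : least P = None <-> forall n, ~ P n.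
Proof.
rewrite /least; case: pselect => [h|h]; split=> //.
- by move=> H; exfalso; case: h => n /asboolP Pn; case: (H n).
- by move=> _ n Pn; apply: h; exists n; apply/asboolP.
Qed.

Lemma least_some (P : nat -> Prop) : (exists n, P n) ->
  exists n, [/\ least P = Some n, P n & forall k, (k < n)%N -> ~ P k].
Proof.
move=> [n Pn]; case E : (least P) => [m|].
  by exists m; move/leastP: (E) => [].
by move/leastN: E => /(_ n).
Qed.

Lemma dmeas_least d (X : measurableType d) (P : nat -> X -> Prop) :
  (forall n, measurable [set x | P n x]) ->
  dmeas (fun x => least (fun n => P n x)).
Proof.
move=> mP; apply: dmeas_fibers; [exact: countableP|case=> [n|]].
- rewrite (_ : mkset _ = [set x | P n x] `&`
    [set x | forall k, (k < n)%N -> ~ P k x]).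
    apply: measurableI => //; apply: measurable_forall => [//|k].
    case: (ltnP k n) => kn.
      rewrite (_ : mkset _ = ~` [set x | P k x]); first exact: measurableC.
      by apply/seteqP; split=> x /=; auto.
    by rewrite (_ : mkset _ = setT) //; apply/seteqP; split.
  by apply/seteqP; split=> x /= /leastP.
- rewrite (_ : mkset _ = [set x | forall n, ~ P n x]).
    by apply: measurable_forall => // n; exact: (measurableC (mP n)).
  by apply/seteqP; split=> x /= /leastN.
Qed.

Section SequenceSpace.
Context d (T : measurableType d).

Definition coord_sets : set (set (nat -> T)) :=
  [set A | exists n B, measurable B /\ A = [set f | B (f n)]].

Definition seqm := g_sigma_algebraType coord_sets.

Lemma measurable_coord n : measurable_fun setT (fun f : seqm => f n).
Proof.
by move=> _ B mB; rewrite setTI; apply: sub_sigma_algebra; exists n, B.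
Qed.

Lemma measurable_seqm d' (X : measurableType d') (f : X -> seqm) :
  (forall n, measurable_fun setT (fun x => f x n)) -> measurable_fun setT f.
Proof.
move=> mf; apply: (@measurability _ _ _ seqm setT f coord_sets) => //.
move=> _ [_ [n [B [mB ->]]] <-].
by apply: (mf n).
Qed.

End SequenceSpace.

Notation cantor := (seqm bool).

Lemma dmeas_coord n : dmeas (fun t : cantor => t n).
Proof. by move=> A; apply: (measurable_preimage (measurable_coord (T := bool) n)). Qed.

Lemma measurable_cantor d (X : measurableType d) (f : X -> cantor) :
  (forall n, measurable [set x | f x n]) -> measurable_fun setT f.
Proof.
move=> mf; apply: measurable_seqm => n.
by apply: (@measurable_fun_bool _ _ _ _ true); rewrite setTI; apply: mf.
Qed.

(** A one-sided inverse is enough to transport measures: every [A] equals [phi @^-1] (psi @^-1[A)],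
    so a measure on [T] is determined by its image on Cantor space. *)
Definition borel_retract d (T : measurableType d) : Prop :=
  exists (phi : T -> cantor) (psi : cantor -> T),
    [/\ measurable_fun setT phi, measurable_fun setT psi & cancel phi psi].

(** The injection [phi] turns equality of points into equality of countably many bits. *)
Lemma measurable_eq d d' (X : measurableType d) (T : measurableType d')
  (u v : X -> T) : borel_retract T -> measurable_fun setT u ->
  measurable_fun setT v -> measurable [set x | u x = v x].
Proof.
move=> [phi [psi [mphi _ phiK]]] mu mv.
rewrite (_ : mkset _ = [set x | forall n, phi (u x) n = phi (v x) n]).
  apply: measurable_forall => // n.
  have mc w : measurable_fun setT w -> dmeas (fun x : X => phi (w x) n).
    by move=> mw; apply: (dmeas_precomp mw (dmeas_precomp mphi (dmeas_coord n))).
  pose f b x := `[< phi (v x) n = b >].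
  rewrite (_ : mkset _ = [set x | f (phi (u x) n) x]).
    suff : dmeas (fun x => f (phi (u x) n) x) by apply.
    apply: dmeas_bind => //; first exact: mc.
    move=> b; apply: dmeas_bool; exact: (mc _ mv [set b]).
  by apply/seteqP; split=> x /= => [->|/asboolP ->] //; apply/asboolP.
apply/seteqP; split=> x /= => [->|h] //.
by apply: (can_inj phiK); apply/funext.
Qed.

Lemma borel_retract_prod d d' (T : measurableType d) (U : measurableType d') :
  borel_retract T -> borel_retract U -> borel_retract (T * U)%type.
Proof.
move=> [f [g [mf mg fK]]] [f' [g' [mf' mg' fK']]].
exists (fun x n => if odd n then f' x.2 n./2 else f x.1 n./2).
exists (fun t => (g (fun n => t n.*2), g' (fun n => t n.*2.+1))).
split.
- apply: measurable_seqm => n /=; case: (odd n) => /=.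
    exact: (measurableT_comp (measurable_coord _)
              (measurableT_comp mf' measurable_snd)).
  exact: (measurableT_comp (measurable_coord _)
            (measurableT_comp mf measurable_fst)).
- apply: measurable_fun_pair.
    by apply: (measurableT_comp mg); apply: measurable_seqm => n;
       exact: measurable_coord.
  by apply: (measurableT_comp mg'); apply: measurable_seqm => n;
     exact: measurable_coord.
- move=> [x y] /=; congr pair.
    rewrite -[RHS]fK; congr g; apply/funext => n.
    by rewrite odd_double doubleK.
  rewrite -[RHS]fK'; congr g'; apply/funext => n.
  by rewrite /= odd_double /= uphalf_double.
Qed.

Lemma small_inv (R : realType) (e : R) : 0 < e ->
  exists n, forall m, (n <= m)%N -> m.+1%:R^-1 < e.
Proof.
move=> e0; have [n ne] := ltr_add_invr e0.
exists n => m nm; rewrite add0r in ne; apply: le_lt_trans ne.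
by rewrite lef_pV2 ?posrE ?ltr0n // ler_nat.
Qed.

(** * Polish spaces as Borel retracts of Cantor space *)

Section PolishCoding.
Variables (R : realType) (T : Type) (dist : T -> T -> R).
Hypothesis pm : polish_metric dist.

Let dist_ge0 x y : 0 <= dist x y.
Proof. by case: pm => -[]. Qed.
Let dist_eq0 x y : dist x y = 0 -> x = y.
Proof. by case: pm => -[_ h] _ _ _ _ /h. Qed.
Let dist_sym x y : dist x y = dist y x.
Proof. by case: pm. Qed.
Let dist_tri x y z : dist x z <= dist x y + dist y z.
Proof. by case: pm. Qed.

Variable D : nat -> T.
Hypothesis denseD : forall x (e : R), 0 < e -> exists n, dist x (D n) < e.

Let e (n : nat) : R := n.+1%:R^-1.
Let e_gt0 n : 0 < e n. Proof. by rewrite invr_gt0 ltr0n. Qed.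
Let small_e (r : R) : 0 < r -> exists n, forall m, (n <= m)%N -> e m < r / 2.
Proof. by move=> r0; apply: small_inv; rewrite divr_gt0. Qed.

(* A point is coded by the list of balls B(D k, 1/(n+1)) containing it; decoding takes
   the limit of the first listed centers of each radius. *)
Definition ball_code (z : T) (m : nat) : bool :=
  if unpickle m is Some (n, k) then dist z (D k) < n.+1%:R^-1 else false.

Definition code_center (t : nat -> bool) (n : nat) : nat :=
  odflt 0%N (least (fun k => t (pickle (n, k)))).

Definition code_good (t : nat -> bool) : Prop :=
  exists z, forall n, dist z (D (code_center t n)) <= n.+1%:R^-1.

Definition ball_decode (t : nat -> bool) : T :=
  if pselect (code_good t) is left h then sval (cid h) else D 0%N.

Lemma code_center_ball z n : dist z (D (code_center (ball_code z) n)) < e n.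
Proof.
have h : exists k : nat, ball_code z (pickle (n, k)).
  by have [k zk] := denseD z (e_gt0 n); exists k; rewrite /ball_code pickleK.
rewrite /code_center; have [k [-> + _]] := least_some h.
by rewrite /ball_code pickleK.
Qed.

Let near_unique z z' (u : nat -> T) :
  (forall n, dist z (u n) <= e n) -> (forall n, dist z' (u n) <= e n) -> z = z'.
Proof.
move=> hz hz'; apply: dist_eq0; apply/eqP; rewrite eq_le dist_ge0 andbT.
apply/ler_addgt0Pr => r r0; rewrite add0r.
have [n /(_ _ (leqnn n)) ner] := small_e r0.
have := dist_tri z (u n) z'; rewrite (dist_sym (u n)).
by have := hz n; have := hz' n; move: (e n) ner => en; lra.
Qed.

Lemma ball_codeK : cancel ball_code ball_decode.
Proof.
move=> z; rewrite /ball_decode; case: pselect => [h|[]]; last first.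
  by exists z => n; exact/ltW/code_center_ball.
case: cid => /= z' hz'; apply: near_unique hz' _ => n.
exact/ltW/code_center_ball.
Qed.

(** Completeness trades the quantifier over points of [T] for countably many inequalities between
    centers, which makes goodness a Borel condition. The nonstrict bounds are the ones that pass to
    the limit. *)
Lemma code_goodP t : code_good t <-> forall nm : nat * nat,
  dist (D (code_center t nm.1)) (D (code_center t nm.2)) <= e nm.1 + e nm.2.
Proof.
split=> [[z hz] [n m] /=|h].
  have := dist_tri (D (code_center t n)) z (D (code_center t m)).
  by rewrite (dist_sym _ z) => /le_trans; apply; apply: lerD; exact: hz.
have [_ _ _ complete _] := pm.
have [|z hz] := complete (fun n => D (code_center t n)).
  move=> r r0; have [N hN] := small_e r0.
  exists N => n m /hN Nn /hN Nm; apply: le_lt_trans (h (n, m)) _ => /=.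
  by lra.
exists z => n; apply/ler_addgt0Pr => r r0.
have [N hN] := hz (r / 2) (divr_gt0 r0 (ltr0n _ 2)).
have [M hM] := small_e r0.
have h1 := hN _ (leq_maxl N M); have h2 := hM _ (leq_maxr N M).
move: (h (n, maxn N M)) h1 h2 => /=.
move: (D (code_center t n)) (D (code_center t (maxn N M))) => x y.
rewrite -/(e n); move: (e (maxn _ _)) (e n) => em en.
have := dist_tri z y x; have := dist_sym z y; have := dist_sym x y; lra.
Qed.

Lemma dmeas_code_center n :
  dmeas (fun t : cantor => code_center t n).
Proof.
apply: (dmeas_comp (odflt 0%N)); apply: dmeas_least => k.
exact: (dmeas_coord (pickle (n, k)) [set true]).
Qed.

Lemma measurable_code_good : measurable [set t : cantor | code_good t].
Proof.
rewrite (_ : mkset _ = [set t : cantor | forall nm : nat * nat,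
  dist (D (code_center t nm.1)) (D (code_center t nm.2)) <= e nm.1 + e nm.2]).
  apply: measurable_forall => [//|[n m] /=].
  pose f k (t : cantor) := dist (D k) (D (code_center t m)) <= e n + e m.
  suff : dmeas (fun t : cantor => f (code_center t n) t) by apply.
  apply: dmeas_bind => //; first exact: dmeas_code_center.
  by move=> k; apply: (dmeas_comp (fun l => dist (D k) (D l) <= e n + e m));
    exact: dmeas_code_center.
by apply/seteqP; split=> t /code_goodP.
Qed.

Lemma measurable_ball_decode_open (U : set T) : metric_open dist U ->
  measurable ([set t : cantor | U (ball_decode t)]).
Proof.
move=> oU.
(* [K n] lists the centers whose closed ball of radius [e n] lies inside [U]. For a good code, the
   decoded point is in [U] exactly when some center of the code belongs to the corresponding [K n].
   Bad codes all decode to [D 0]. *)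
pose K n := [set k | forall z, dist z (D k) <= e n -> U z].
rewrite (_ : mkset _ =
  ([set t : cantor | code_good t] `&` [set t : cantor | exists n, K n (code_center t n)])
  `|` (~` [set t : cantor | code_good t] `&` [set _ | U (D 0%N)])); last first.
  apply/seteqP; split=> t /=; rewrite /ball_decode.
    case: pselect => [[z hz] /=|h Ut]; last by right.
    case: cid => {hz}z hz /= Uz; left; split; first by exists z.
    have [r r0 hr] := oU _ Uz.
    have [n /(_ _ (leqnn n)) ner] := small_e r0.
    exists n => z' hz'; apply: hr.
    have := hz n; have := dist_tri z (D (code_center t n)) z'.
    rewrite -/(e n) (dist_sym (D _)); move: (e n) ner hz' => en; lra.
  case=> [[gt [n hK]]|[ngt UD]]; case: pselect => // h.
  by case: cid => z hz /=; apply: hK.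
apply: measurableU; apply: measurableI.
- exact: measurable_code_good.
- apply: measurable_exists => // n.
  exact: (@dmeas_code_center n (K n)).
- by apply: measurableC; exact: measurable_code_good.
- exact: measurable_const.
Qed.

End PolishCoding.

Lemma metric_open_ball (R : realType) (T : Type) (dist : T -> T -> R) y r :
  polish_metric dist -> metric_open dist [set x | dist x y < r].
Proof.
case=> _ sym tri _ _ x /= xr; exists (r - dist x y); first by rewrite subr_gt0.
by move=> z xz; have := tri z x y; have := sym z x; lra.
Qed.

Lemma standard_borel_retract (R : realType) d (T : measurableType d) :
  standard_borel R T -> borel_retract T.
Proof.
case=> dist [pm mT]; have [_ _ _ _ [D denseD]] := pm.
exists (ball_code dist D), (ball_decode dist D); split.
- apply: measurable_cantor => m; rewrite /ball_code.
  case: (unpickle m) => [[n k]|]; last exact: measurable_const.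
  apply/mT; apply: sub_sigma_algebra.
  exact: metric_open_ball pm.
- apply: (@measurability _ _ cantor T setT _ (metric_open dist)).
    by apply/seteqP; split=> A /mT.
  move=> _ [U oU <-]; rewrite setTI.
  exact: (@measurable_ball_decode_open R T dist pm D U oU).
- exact: ball_codeK.
Qed.

(** A real is coded by the rationals below it and decoded as a supremum. *)
Lemma borel_retract_real (R : realType) : borel_retract (measurableTypeR R).
Proof.
pose q n : R := if unpickle n is Some r then ratr r else 0.
pose good (t : cantor) := (exists n, t n) /\ exists N : nat, forall n, t n -> q n <= N%:R.
pose S (t : cantor) := [set q n | n in [set n | t n]].
exists (fun r n => q n < r), (fun t => sup (S t)); split.
- apply: measurable_cantor => n.
  rewrite (_ : mkset _ = `]q n, +oo[%classic); first exact: measurable_itv.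
  by apply/seteqP; split=> x /=; rewrite in_itv /= andbT.
- have mgood : measurable [set t | good t].
    apply: measurableI; apply: measurable_exists => // n.
      exact: (dmeas_coord n [set true]).
    apply: measurable_forall => // m; apply: measurable_imply.
      exact: (dmeas_coord m [set true]).
    exact: measurable_const.
  apply: (@measurability _ _ cantor (measurableTypeR R) setT _ (@RGenOInfty.G R)).
    exact: RGenOInfty.measurableE.
  move=> _ [_ [a ->] <-]; rewrite setTI.
  (* [sup] returns 0 on empty or unbounded sets, so the codes that are not good lie in the preimage
     exactly when [a < 0]. *)
  rewrite (_ : _ @^-1` _ = ([set t | good t] `&`
     [set t : cantor | exists n, t n /\ a < q n]) `|`
     (~` [set t | good t] `&` [set _ | a < 0])).
    apply: measurableU; apply: measurableI => //.
    + apply: measurable_exists => // n; apply: measurableI.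
        exact: (dmeas_coord n [set true]).
      exact: measurable_const.
    + exact: measurableC.
    + exact: measurable_const.
  have supS t : good t -> has_sup (S t).
    move=> [[n tn] [N hN]]; split; first by exists (q n), n.
    by exists N%:R => _ [m tm <-]; exact: hN.
  have nsupS t : ~ good t -> sup (S t) = 0.
    move=> ng; apply: sup_out => -[[_ [n tn _]] [M hM]]; apply: ng.
    split; first by exists n.
    exists (Num.bound `|M|) => m tm; apply: (@le_trans _ _ M); first by apply: hM; exists m.
    by apply: (le_trans (ler_norm _)); exact/ltW/archi_boundP/normr_ge0.
  apply/seteqP; split=> t /=; rewrite in_itv /= andbT.
    move=> aS; case: (pselect (good t)) => gt; last by right; rewrite -(nsupS t gt).
    left; split=> //; have [_ [n tn <-] an] := sup_gt (supS t gt).1 aS.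
    by exists n.
  case=> [[gt [n [tn an]]]|[ng a0]]; last by rewrite nsupS.
  apply: (lt_le_trans an); apply: ub_le_sup; first exact: (supS t gt).2.
  by exists n.
- move=> r; pose t : cantor := fun n => q n < r.
  have qE x : q (pickle x) = ratr x by rewrite /q pickleK.
  have ne : exists n, t n.
    have /rat_in_itvoo[x] : r - 1 < r by rewrite ltrBlDr ltrDl.
    by rewrite in_itv /= => /andP[_ xr]; exists (pickle x); rewrite /t qE.
  have ubS : ubound (S t) r by move=> _ [n tn <-]; exact: ltW.
  apply/eqP; rewrite eq_le; apply/andP; split.
    apply: ge_sup => //.
    by case: ne => n tn; exists (q n), n.
  rewrite leNgt; apply/negP => /rat_in_itvoo[x]; rewrite in_itv /= => /andP[Sx xr].
  suff : ratr x <= sup (S t) by rewrite leNgt Sx.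
  apply: ub_le_sup; first by exists r.
  by exists (pickle x); rewrite /t /= ?qE.
Qed.

(** * Probability measures as images of Lebesgue measure *)

Section Pushforward.
Context d d' (T : measurableType d) (U : measurableType d') (R : realType).

Definition push_measure (m : {measure set T -> \bar R}) (f : T -> U)
  (mf : measurable_fun setT f) : {measure set U -> \bar R} :=
  measure_function_pushforward__canonical__measure_function_Measure m mf.

Lemma push_measureE (m : {measure set T -> \bar R}) (f : T -> U)
  (mf : measurable_fun setT f) A : push_measure m mf A = m (f @^-1` A).
Proof. by []. Qed.

Definition push_prob (P : probability T R) (f : T -> U)
  (mf : measurable_fun setT f) : probability U R :=
  distribution P (mfun_Sub (mem_set mf)).

End Pushforward.

Lemma uniform_itv (R : realType) : exists P : probability (measurableTypeR R) R,
  forall a b : R, 0 <= a -> a <= b -> b <= 1 -> P `[a, b[%classic = (b - a)%:E.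
Proof.
exists (uniform_prob (@ltr01 R)) => a b a0 ab b1.
rewrite /= /uniform_prob integral_uniform_pdf.
rewrite (_ : _ `&` _ = `[a, b[%classic); last first.
  apply/seteqP; split=> x /=; rewrite !in_itv /=; first by case.
  by move=> /andP[ax xb]; rewrite ax xb; split=> //; lra.
rewrite (eq_integral (cst 1%E)) => [|x]; last first.
  rewrite inE /= in_itv /= => /andP[ax xb]; rewrite /uniform_pdf.
  by rewrite (_ : 0 <= x <= 1) ?subr0 ?invr1 //; lra.
rewrite integral_cst //= mul1e lebesgue_measure_itv /= lte_fin.
case: ifPn => [//|]; rewrite -leNgt => ba.
by rewrite (_ : b = a) ?subrr //; apply/eqP; rewrite eq_le ba ab.
Qed.

Lemma measure_eq_on (R : realType) d (T : measurableType d)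
  (m : {measure set T -> \bar R}) (A B D : set T) :
  measurable A -> measurable B -> measurable D -> m (~` D) = 0%E ->
  (forall x, D x -> A x <-> B x) -> m A = m B.
Proof.
move=> mA mB mD D0 AB.
have mC : measurable (~` D) by exact: measurableC.
have H E : measurable E -> m E = m (E `&` D).
  move=> mE; rewrite (measureDI m mE mD).
  rewrite setDE (subset_measure0 _ mC (@subIsetr _ E (~` D)) D0) ?add0e //.
  exact: measurableI.
rewrite H // [RHS]H //; congr (m _); apply/seteqP.
by split=> x [] + Dx => /(AB _ Dx).
Qed.

(* Most recent bit first, so that extending a prefix is a [cons]. *)
Fixpoint rprefix (t : nat -> bool) (n : nat) : seq bool :=
  if n is n'.+1 then t n' :: rprefix t n' else [::].

Lemma size_rprefix t n : size (rprefix t n) = n.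
Proof. by elim: n => //= n ->. Qed.

Lemma rprefix_trunc t t' m n : (n <= m)%N ->
  rprefix t m = rprefix t' m -> rprefix t n = rprefix t' n.
Proof.
elim: m => [|m IH] in n *; first by rewrite leqn0 => /eqP ->.
rewrite leq_eqVlt => /predU1P[-> //|]; rewrite ltnS => nm [_ h]; exact: IH.
Qed.

Definition cylinder (s : seq bool) : set (nat -> bool) :=
  [set t | rprefix t (size s) = s].

Lemma dmeas_rprefix n : dmeas (fun t : cantor => rprefix t n).
Proof.
elim: n => [|n IH]; first exact: dmeas_cst.
apply: (@dmeas_bind _ cantor (seq bool) (seq bool)
          (fun s t => t n :: s) (fun t => rprefix t n)) => //= s.
exact: (dmeas_comp (fun b => b :: s) (dmeas_coord n)).
Qed.

Lemma measurable_cylinder s : measurable (cylinder s : set cantor).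
Proof. exact: (@dmeas_rprefix (size s) [set s]). Qed.

Lemma cylinder_split s :
  cylinder s = cylinder (true :: s) `|` cylinder (false :: s).
Proof.
apply/seteqP; split=> t /=; rewrite /cylinder /=.
  by move=> ->; case: (t (size s)); [left|right].
by case=> -[].
Qed.

Lemma cylinder_measure_unique (R : realType)
  (m1 m2 : {measure set cantor -> \bar R}) : (m1 setT < +oo)%E ->
  (forall s, m1 (cylinder s) = m2 (cylinder s)) ->
  forall A, measurable A -> m1 A = m2 A.
Proof.
move=> fin1 m12.
have nilT : cylinder [::] = setT by apply/seteqP; split.
(* Two cylinders are nested or disjoint; adding the empty set makes the family stable under
   intersection. *)
pose G := [set A : set cantor | A = set0 \/ exists s, A = cylinder s].
apply: (measure_unique G (fun=> setT)) => //.
- apply/seteqP; split; last first.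
    apply: smallest_sub; first exact: sigma_algebra_measurable.
    by move=> _ [->|[s ->]] //; exact: measurable_cylinder.
  apply: smallest_sub; first exact: smallest_sigma_algebra.
  move=> _ [n [B [_ ->]]].
  (* A condition on coordinate [n] is a countable union of cylinders of length [n.+1]; that
     coordinate is the head of the prefix because the most recent bit comes first. *)
  rewrite (_ : mkset _ = [set t : cantor | exists s,
     (size s = n.+1 /\ B (head false s)) /\ cylinder s t]).
    apply: (@measurable_exists _ (g_sigma_algebraType G)) => // s.
    case: (pselect (size s = n.+1 /\ B (head false s))) => hs.
      rewrite (_ : mkset _ = cylinder s); last by apply/seteqP; split=> t //= [].
      by apply: sub_sigma_algebra; right; exists s.
    rewrite (_ : mkset _ = set0); last by apply/seteqP; split=> t //= [].
    exact: sigma_algebra0.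
  apply/seteqP; split=> t /=.
    move=> Bt; exists (rprefix t n.+1).
    by rewrite /cylinder /= !size_rprefix.
  by move=> [s [[ss Bs]]]; rewrite /cylinder /= ss => es; rewrite -es in Bs.
- move=> A B [->|[s ->]]; first by left; rewrite set0I.
  case=> [->|[s' ->]]; first by left; rewrite setI0.
  wlog ss' : s s' / (size s <= size s')%N.
    move=> H; case: (leqP (size s) (size s')); first exact: H.
    by move=> /ltnW /H; rewrite setIC.
  case: (pselect (exists t, (cylinder s `&` cylinder s') t)) => [[t [h h']]|h].
    right; exists s'; apply/seteqP; split=> t' /=; first by case.
    move=> h''; split=> //; rewrite /cylinder /= -[RHS]h.
    by apply: rprefix_trunc ss' _; rewrite h' h''.
  by left; apply/seteqP; split=> // t ht; apply: h; exists t.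
- by move=> _; right; exists [::].
- by rewrite bigcup_const.
- by move=> _ [->|[s ->]] //; rewrite !measure0.
Qed.

Section Splitting.
Context (R : realType).
Implicit Type w : seq bool -> R.

(* [0, 1[ is split recursively into intervals of length [w s], the child [false :: s]
   lying to the left of [true :: s]; [low w s] is the left end of the interval of [s],
   and [split_code w x] is the branch of intervals containing [x]. *)
Fixpoint low w (s : seq bool) : R :=
  if s is b :: s' then low w s' + (if b then w (false :: s') else 0) else 0.

Fixpoint split_prefix w (x : R) (n : nat) : seq bool :=
  if n is n'.+1 then
    let s := split_prefix w x n' in (low w s + w (false :: s) <= x) :: s
  else [::].

Definition split_code w (x : R) (n : nat) : bool :=
  let s := split_prefix w x n in low w s + w (false :: s) <= x.

Lemma rprefix_split_code w x n : rprefix (split_code w x) n = split_prefix w x n.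
Proof. by elim: n => //= n ->. Qed.

(** The consistency conditions satisfied by the cylinder values of a probability measure;
    [split_code_law] shows conversely that each such system comes from a measure. *)
Definition weight w := [/\ forall s, 0 <= w s, w [::] = 1 &
  forall s, w s = w (true :: s) + w (false :: s)].

Lemma low_bounds w s : weight w -> 0 <= low w s /\ low w s + w s <= 1.
Proof.
case=> w0 w1 wD; elim: s => [|b s [IH1 IH2]] /=; first by rewrite w1 add0r.
have := w0 (true :: s); have := w0 (false :: s); have := wD s.
by case: b; lra.
Qed.

Lemma split_prefixP w s x : weight w -> 0 <= x < 1 ->
  split_prefix w x (size s) = s <-> low w s <= x < low w s + w s.
Proof.
move=> [w0 w1 wD] x01; elim: s => [|b s IH] /=; first by rewrite w1 add0r.
have := w0 (true :: s); have := w0 (false :: s); have := wD s => h1 h2 h3.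
split=> [[+ h]|h].
  rewrite h; move/IH: h => /andP[]; case: b => h4 h5.
    by move=> h6; rewrite h6 /=; lra.
  by move=> /negbT; rewrite -ltNge => h6; lra.
have h4 : split_prefix w x (size s) = s by apply/IH; case: b h; lra.
rewrite h4; congr cons; case: b h => /andP[h5 h6]; first by [].
by apply/negbTE; rewrite -ltNge; lra.
Qed.

(** Up to the null complement of [[0, 1[], the preimage of the cylinder is the interval of length
    [w s] starting at [low w s]. *)
Lemma split_code_law w (P : probability (measurableTypeR R) R) :
  (forall a b : R, 0 <= a -> a <= b -> b <= 1 -> P `[a, b[%classic = (b - a)%:E) ->
  weight w -> forall s, measurable (split_code w @^-1` cylinder s : set R) ->
  P (split_code w @^-1` cylinder s) = (w s)%:E.
Proof.
move=> Pitv ww s ms; have [w0 w1 wD] := ww; have [l0 l1] := low_bounds s ww.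
have PT : P (~` `[0, 1[%classic) = 0%E.
  by rewrite probability_setC ?Pitv ?subr0 ?subee //; lra.
have -> : (w s)%:E = P `[low w s, low w s + w s[%classic.
  by rewrite Pitv ?lerDl // addrAC subrr add0r.
apply: (@measure_eq_on R _ (measurableTypeR R) P _ _ `[0, 1[%classic ms).
- exact: measurable_itv.
- exact: measurable_itv.
- exact: PT.
move=> x; rewrite /= !in_itv /= => x01; rewrite -(split_prefixP _ ww x01).
by rewrite /cylinder /= rprefix_split_code.
Qed.

(** Joint measurability in the parameter and the real number is what allows Fubini to be applied
    when the weights vary with the point, as they do for ergodic components. *)
Lemma measurable_split_code d (Y : measurableType d) (w : Y -> seq bool -> R) :
  (forall s, measurable_fun setT (fun y => w y s)) ->
  measurable_fun setT
    (fun p : Y * measurableTypeR R => split_code (w p.1) p.2 : cantor).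
Proof.
move=> mw.
have mlow s : measurable_fun setT (fun y => low (w y) s).
  elim: s => [|b s IH] /=; first exact: measurable_cst.
  by apply: measurable_funD => //; case: b => //; exact: measurable_cst.
have mstep s : measurable [set p : Y * measurableTypeR R |
    low (w p.1) s + w p.1 (false :: s) <= p.2].
  rewrite -[X in measurable X]setTI; apply: measurable_fun_le => //.
    apply: measurable_funD.
      exact: (measurableT_comp (mlow s) measurable_fst).
    exact: (measurableT_comp (mw (false :: s)) measurable_fst).
have dmeas_rel s : dmeas (fun p : Y * measurableTypeR R =>
    low (w p.1) s + w p.1 (false :: s) <= p.2).
  move=> A; rewrite (_ : _ @^-1` _ = (fun p : Y * measurableTypeR R =>
    `[< low (w p.1) s + w p.1 (false :: s) <= p.2 >]) @^-1` A).
    exact: (dmeas_bool (mstep s)).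
  by apply/seteqP; split=> p; rewrite /= asboolb.
have mpre n : dmeas (fun p : Y * measurableTypeR R => split_prefix (w p.1) p.2 n).
  elim: n => [|n IH]; first exact: dmeas_cst.
  apply: (@dmeas_bind _ _ (seq bool) (seq bool)
     (fun s p => (low (w p.1) s + w p.1 (false :: s) <= p.2) :: s)
     (fun p => split_prefix (w p.1) p.2 n)) => //= s.
  apply: (dmeas_comp (fun b => b :: s)).
  exact: dmeas_rel.
apply: measurable_cantor => n; rewrite /split_code /=.
pose f s (p : Y * measurableTypeR R) := low (w p.1) s + w p.1 (false :: s) <= p.2.
suff : dmeas (fun p => f (split_prefix (w p.1) p.2 n) p) by move/(_ [set true]).
exact: (@dmeas_bind _ _ bool (seq bool) f
  (fun p => split_prefix (w p.1) p.2 n) _ (mpre n) dmeas_rel).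
Qed.

End Splitting.

Lemma code_measure_unique (R : realType) d (T : measurableType d)
  (phi : T -> cantor) (psi : cantor -> T)
  (m1 m2 : {measure set T -> \bar R}) :
  measurable_fun setT phi -> measurable_fun setT psi -> cancel phi psi ->
  (m1 setT < +oo)%E ->
  (forall s, m1 (phi @^-1` cylinder s) = m2 (phi @^-1` cylinder s)) ->
  forall A, measurable A -> m1 A = m2 A.
Proof.
move=> mphi mpsi phiK fin1 m12 A mA.
have -> : A = phi @^-1` (psi @^-1` A).
  by apply/seteqP; split=> x; rewrite /= phiK.
rewrite -!(push_measureE _ mphi); apply: cylinder_measure_unique => //.
exact: measurable_preimage.
Qed.

Section UniformCoding.
Context (R : realType) (lam : probability (measurableTypeR R) R).
Hypothesis lam_itv : forall a b : R,
  0 <= a -> a <= b -> b <= 1 -> lam `[a, b[%classic = (b - a)%:E.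

Lemma prob_weight d (T : measurableType d) (P : probability T R)
  (phi : T -> cantor) : measurable_fun setT phi ->
  weight (fun s => fine (P (phi @^-1` cylinder s))).
Proof.
move=> mphi; have mc s := measurable_preimage mphi (measurable_cylinder s).
split=> [s||s]; first exact: fine_ge0.
  rewrite (_ : _ @^-1` _ = setT) ?probability_setT //.
  by apply/seteqP; split.
rewrite cylinder_split preimage_setU measureU //.
- by rewrite fineD // fin_num_measure.
- by apply/seteqP; split=> x //= [] [+ _] [+ _] => ->.
Qed.

Lemma prob_push_uniform d (T : measurableType d) (P : probability T R) :
  borel_retract T -> exists2 beta : measurableTypeR R -> T,
    measurable_fun setT beta &
    forall A, measurable A -> lam (beta @^-1` A) = P A.
Proof.
move=> [phi [psi [mphi mpsi phiK]]].
pose w s := fine (P (phi @^-1` cylinder s)).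
have mw : measurable_fun setT (split_code w : measurableTypeR R -> cantor).
  (* A single weight is a constant family over [unit]. *)
  have := @measurable_split_code R _ unit (fun=> w) (fun s => measurable_cst _).
  by move/measurableT_comp => /(_ _ _ _ _ (pair1_measurable (tt : unit))).
exists (psi \o split_code w); first exact: measurableT_comp.
move=> A mA; rewrite comp_preimage.
have -> : A = phi @^-1` (psi @^-1` A).
  by apply/seteqP; split=> x; rewrite /= phiK.
rewrite -(push_measureE _ mphi) -(push_measureE _ mw).
have -> : psi @^-1` (phi @^-1` (psi @^-1` A)) = psi @^-1` A.
  by apply/seteqP; split=> x; rewrite /= phiK.
apply: cylinder_measure_unique.
- suff : (lam setT < +oo)%E by [].
  by rewrite probability_setT ltry.
- move=> s; transitivity (w s)%:E.
    apply: (split_code_law lam_itv (prob_weight P mphi)).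
    exact: (measurable_preimage mw (measurable_cylinder s)).
  rewrite fineK // fin_num_measure //.
  exact: (measurable_preimage mphi (measurable_cylinder s)).
- exact: measurable_preimage.
Qed.

Definition box d (T : measurableType d) (N : nat) (A : nat -> set T) :
  set (nat -> T) := [set f | forall n, (n < N)%N -> A n (f n)].

Lemma measurable_box d (T : measurableType d) N (A : nat -> set T) :
  (forall n, measurable (A n)) -> measurable (box N A : set (seqm T)).
Proof.
move=> mA; apply: measurable_forall => // n; apply: measurable_imply.
  exact: measurable_const.
exact: (measurable_preimage (measurable_coord n) (mA n)).
Qed.

Lemma box_measure_unique d (T : measurableType d)
  (m1 m2 : {measure set (seqm T) -> \bar R}) : (m1 setT < +oo)%E ->
  (forall N A, (forall n, measurable (A n)) -> m1 (box N A) = m2 (box N A)) ->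
  forall B, measurable B -> m1 B = m2 B.
Proof.
move=> fin1 m12.
pose G := [set B : set (seqm T) | exists N (A : nat -> set T),
  (forall n, measurable (A n)) /\ B = box N A].
apply: (measure_unique G (fun=> setT)) => //.
- apply/seteqP; split.
    apply: smallest_sub; first exact: smallest_sigma_algebra.
    move=> _ [n [B [mB ->]]]; apply: sub_sigma_algebra.
    exists n.+1, (fun k => if k == n then B else setT); split.
      by move=> k; case: ifP.
    apply/seteqP; split=> f /=.
      by move=> Bf k kn; case: eqP => // ->.
    by move=> /(_ n (ltnSn n)); rewrite eqxx.
  apply: smallest_sub; first exact: sigma_algebra_measurable.
  by move=> _ [N [A [mA ->]]]; exact: measurable_box.
- move=> _ _ [N [A [mA ->]]] [M [B [mB ->]]].
  exists (maxn N M), (fun n => [set z | ((n < N)%N -> A n z) /\ ((n < M)%N -> B n z)]).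
  split.
    move=> n; apply: measurableI.
      by apply: measurable_imply; [exact: measurable_const|exact: mA].
    by apply: measurable_imply; [exact: measurable_const|exact: mB].
  apply/seteqP; split=> f /=.
    by move=> [h1 h2] n _; split; [exact: h1|exact: h2].
  move=> h; split=> n nN; have := h n; rewrite leq_max nN ?orbT => /(_ isT) [].
    by move=> + _; apply.
  by move=> _; apply.
- by move=> _; exists 0%N, (fun=> setT); split=> //; apply/seteqP; split.
- by rewrite bigcup_const.
- by move=> _ [N [A [mA ->]]]; apply: m12.
Qed.

(** * Independent sequences with a given law *)

Section Iid.
Context d (Z : measurableType d) (nu : probability Z R).
Hypothesis rZ : borel_retract Z.

(* If [beta] sends [lam] to [nu \x lam], then iterating its second component and
   reading off the first one produces an independent sequence. *)
Lemma iid_prob : exists P : probability (seqm Z) R,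
  forall N A, (forall n, measurable (A n)) ->
    P (box N A) = (\prod_(n < N) fine (nu (A n)))%:E.
Proof.
have [beta mbeta lawb] := prob_push_uniform (nu \x lam)%E
  (borel_retract_prod rZ (borel_retract_real R)).
have m1 := measurableT_comp measurable_fst mbeta.
have m2 := measurableT_comp measurable_snd mbeta.
pose f (x : measurableTypeR R) (n : nat) := (beta (iter n (snd \o beta) x)).1.
have mf : measurable_fun setT (f : _ -> seqm Z).
  apply: measurable_seqm => n; rewrite /f.
  apply: (measurableT_comp m1); elim: n => [|n IH] /=; first exact: measurable_id.
  exact: (measurableT_comp m2 IH).
exists (push_prob lam mf) => N; elim: N => [|N IH] A mA.
  rewrite big_ord0 (_ : box 0 A = setT) ?probability_setT //.
  by apply/seteqP; split.
have mfB : measurable (f @^-1` box N (fun n => A n.+1)).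
  by apply: (measurable_preimage mf); exact: measurable_box.
transitivity (nu (A 0%N) * lam (f @^-1` box N (fun n => A n.+1)))%E; last first.
  have <- : push_prob lam mf (box N (fun n => A n.+1)) =
    lam (f @^-1` box N (fun n => A n.+1)) by [].
  rewrite IH // big_ord_recl EFinM fineK //.
  exact: fin_num_measure.
rewrite -product_measure1E //.
rewrite -lawb; last first.
  exact: measurableX.
congr (lam _); apply/seteqP; split=> x /=.
  move=> h; split; first exact: (h 0%N).
  by move=> n nN; have := h n.+1 nN; rewrite /f iterSr.
by move=> [h0 h] [_|n nN]; [exact: h0|rewrite /f iterSr; exact: h].
Qed.

End Iid.
End UniformCoding.

Section IidReindex.
Context (R : realType) d (Z : measurableType d) (nu : probability Z R).
Context (P : probability (seqm Z) R).
Hypothesis Pbox : forall N A, (forall n, measurable (A n)) ->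
  P (box N A) = (\prod_(n < N) fine (nu (A n)))%:E.

(** Coordinates outside [s] are padded with [setT] and contribute factors 1, which reduces the claim
    to an initial segment. *)
Lemma iid_finite (s : seq nat) (A : nat -> set Z) : uniq s ->
  (forall n, measurable (A n)) ->
  P [set f | forall k, k \in s -> A k (f k)] = (\prod_(k <- s) fine (nu (A k)))%:E.
Proof.
move=> us mA; pose A' k := if k \in s then A k else setT.
pose N := (\max_(k <- s) k).+1.
have sN k : k \in s -> (k < N)%N by move=> ks; rewrite ltnS; exact: leq_bigmax_seq.
have mA' k : measurable (A' k) by rewrite /A'; case: ifP.
have -> : [set f | forall k, k \in s -> A k (f k)] = box N A'.
  apply/seteqP; split=> f /= h k => [_|ks]; first by rewrite /A'; case: ifP => // /h.
  by have := h k (sN k ks); rewrite /A' ks.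
rewrite Pbox //; congr EFin.
rewrite -(big_mkord xpredT (fun n => fine (nu (A' n)))).
have -> : \prod_(0 <= n < N) fine (nu (A' n)) =
    \prod_(0 <= n < N | n \in s) fine (nu (A n)).
  rewrite [RHS]big_mkcond /=; apply: eq_bigr => n _; rewrite /A'.
  by case: ifP => // _; rewrite probability_setT.
rewrite -big_filter; apply: perm_big; apply: uniq_perm => //.
  by rewrite filter_uniq // iota_uniq.
move=> k; rewrite mem_filter mem_index_iota /=.
by case ks : (k \in s) => //=; rewrite sN.
Qed.

Lemma iid_coord k (A : set Z) : measurable A ->
  P [set f | A (f k)] = nu A.
Proof.
move=> mA; have := @iid_finite [:: k] (fun=> A) isT (fun=> mA).
rewrite big_seq1 fineK ?fin_num_measure // => <-; congr (P _).
apply/seteqP; split=> f /= => [h j|]; first by rewrite inE => /eqP ->.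
by apply; rewrite inE.
Qed.

(** Distinct coordinates stay independent under an injective reindexing, and each keeps its law
    under a [nu]-preserving map. The fibre maps of the co-induced action have this form. *)
Lemma iid_reindex (pi : nat -> nat) (g : nat -> Z -> Z) (B : set (seqm Z)) :
  injective pi -> (forall n, measurable_fun setT (g n)) ->
  (forall n A, measurable A -> nu (g n @^-1` A) = nu A) -> measurable B ->
  P ((fun f n => g n (f (pi n))) @^-1` B) = P B.
Proof.
move=> pi_inj mg gnu mB.
have mT : measurable_fun setT ((fun f n => g n (f (pi n))) : seqm Z -> seqm Z).
  by apply: measurable_seqm => n; exact: measurableT_comp (mg n) (measurable_coord _).
rewrite -(push_measureE _ mT).
apply: box_measure_unique mB => //.
  suff : (P setT < +oo)%E by []. by rewrite probability_setT ltry.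
move=> N A mA; rewrite push_measureE.
(* A left inverse of [pi]; the sets [A'] are only tested at indices in the image of [pi], where
   [invK] applies. *)
pose inv k := odflt 0%N (least (fun n => pi n = k)).
have invK n : inv (pi n) = n.
  rewrite /inv; have [m [-> /pi_inj -> _]] : exists m,
      [/\ least (fun m => pi m = pi n) = Some m, pi m = pi n &
        forall k, (k < m)%N -> ~ pi k = pi n] by apply: least_some; exists n.
  by [].
pose A' k := g (inv k) @^-1` A (inv k).
have mA' k : measurable (A' k) by apply: measurable_preimage.
transitivity (P [set f | forall k, k \in map pi (iota 0 N) -> A' k (f k)]).
  congr (P _); apply/seteqP; split=> f /= h.
    move=> _ /mapP[n nN ->]; rewrite /A' invK; apply: h.
    by rewrite mem_iota in nN.
  move=> n nN; have := h (pi n) (map_f pi _); rewrite mem_iota /A' invK.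
  by apply.
transitivity (\prod_(n < N) fine (nu (A n)))%:E; last exact/esym/Pbox.
rewrite iid_finite // ?map_inj_uniq ?iota_uniq // big_map; congr EFin.
rewrite -(big_mkord xpredT (fun n => fine (nu (A n)))) /index_iota subn0.
by apply: eq_bigr => n _; rewrite /A' invK gnu.
Qed.

End IidReindex.

(** * The mean ergodic theorem *)

Section BoundedIntegral.
Context (R : realType) d (T : measurableType d).
Implicit Types (f g : T -> R) (m : probability T R).

(** These functions form an algebra, and on it the real-valued [expect] is linear under every
    probability measure at once. *)
Definition bdd_meas f := measurable_fun setT f /\ exists M, forall x, `|f x| <= M.

Lemma bdd_cst (r : R) : bdd_meas (fun=> r).
Proof. by split; [exact: measurable_cst|exists `|r|]. Qed.

Lemma bddD f g : bdd_meas f -> bdd_meas g -> bdd_meas (fun x => f x + g x).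
Proof.
move=> [mf [M fM]] [mg [N gN]]; split; first exact: measurable_funD.
by exists (M + N) => x; apply: (le_trans (ler_normD _ _)); exact: lerD.
Qed.

Lemma bddM f g : bdd_meas f -> bdd_meas g -> bdd_meas (fun x => f x * g x).
Proof.
move=> [mf [M fM]] [mg [N gN]]; split; first exact: measurable_funM.
by exists (M * N) => x; rewrite normrM; apply: ler_pM.
Qed.

Lemma bddZ (r : R) f : bdd_meas f -> bdd_meas (fun x => r * f x).
Proof. by move=> bf; apply: bddM => //; exact: bdd_cst. Qed.

Lemma bddB f g : bdd_meas f -> bdd_meas g -> bdd_meas (fun x => f x - g x).
Proof.
move=> bf bg.
have -> : (fun x => f x - g x) = (fun x => f x + (-1) * g x).
  by apply/funext => x; rewrite mulN1r.
by apply: bddD => //; exact: bddZ.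
Qed.

Lemma bdd_norm f : bdd_meas f -> bdd_meas (fun x => `|f x|).
Proof.
move=> [mf [M fM]]; split; first exact: measurableT_comp.
by exists M => x; rewrite normr_id.
Qed.

Lemma bdd_indic (A : set T) : measurable A -> bdd_meas (\1_A : T -> R).
Proof.
move=> mA; split; first exact: measurable_indic.
by exists 1 => x; rewrite indicE; case: (_ \in _); rewrite ?normr1 ?normr0.
Qed.

Lemma bdd_unit f : measurable_fun setT f -> (forall x, 0 <= f x <= 1) ->
  bdd_meas f.
Proof.
by move=> mf f01; split=> //; exists 1 => x; have := f01 x; rewrite ler_norml; lra.
Qed.

Definition expect m f : R := Rintegral m setT f.

Lemma bdd_integrable m f : bdd_meas f -> m.-integrable setT (EFin \o f).
Proof.
move=> [mf [M fM]]; apply: measurable_bounded_integrable => //.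
  suff : (m setT < +oo)%E by [].
  by rewrite probability_setT ltry.
exists M; split; first exact: num_real.
by move=> y My x _ /=; exact: (le_trans (fM x) (ltW My)).
Qed.

Lemma expect_integral m f : bdd_meas f ->
  (\int[m]_x (f x)%:E)%E = (expect m f)%:E.
Proof.
move=> bf; rewrite /expect /Rintegral fineK //.
exact: (integrable_fin_num measurableT (bdd_integrable m bf)).
Qed.

Lemma expectD m f g : bdd_meas f -> bdd_meas g ->
  expect m (fun x => f x + g x) = expect m f + expect m g.
Proof. by move=> bf bg; apply: RintegralD => //; exact: bdd_integrable. Qed.

Lemma expectZ m r f : bdd_meas f -> expect m (fun x => r * f x) = r * expect m f.
Proof. by move=> bf; apply: RintegralZl => //; exact: bdd_integrable. Qed.

Lemma expectB m f g : bdd_meas f -> bdd_meas g ->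
  expect m (fun x => f x - g x) = expect m f - expect m g.
Proof. by move=> bf bg; apply: RintegralB => //; exact: bdd_integrable. Qed.

Lemma expect_cst m r : expect m (fun=> r) = r.
Proof.
rewrite /expect Rintegral_cst //.
have -> : fine (m setT) = 1 by rewrite probability_setT.
by rewrite mulr1.
Qed.

Lemma expect_ge0 m f : (forall x, 0 <= f x) -> 0 <= expect m f.
Proof. by move=> f0; apply: Rintegral_ge0. Qed.

Lemma expect_le m f g : bdd_meas f -> bdd_meas g -> (forall x, f x <= g x) ->
  expect m f <= expect m g.
Proof. by move=> bf bg fg; apply: le_Rintegral => //; exact: bdd_integrable. Qed.

Lemma expect_norm m f : bdd_meas f -> `|expect m f| <= expect m (fun x => `|f x|).
Proof. by move=> bf; apply: le_normr_Rintegral => //; exact: bdd_integrable. Qed.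

Lemma expect_indic m A : measurable A -> (expect m (\1_A))%:E = m A.
Proof.
move=> mA; rewrite -expect_integral; last exact: bdd_indic.
by rewrite integral_indic // setIT.
Qed.

Lemma eq_expect m f g : f =1 g -> expect m f = expect m g.
Proof. by move=> fg; apply: eq_Rintegral => x _; exact: fg. Qed.

Lemma expect0_ae m f : bdd_meas f -> expect m (fun x => `|f x|) = 0 ->
  m [set x | f x != 0] = 0%E.
Proof.
move=> bf E0; have mf : measurable_fun setT (EFin \o f) by apply/measurable_EFinP; case: bf.
have : (\int[m]_x `|(f x)%:E|)%E = 0%E.
  by have := expect_integral m (bdd_norm bf); rewrite E0.
move/(ae_eq_integral_abs m measurableT mf) => [N [mN N0 sN]].
have mS : measurable [set x | f x != 0].
  have mP := measurable_preimage bf.1 (measurableC (measurable_set1 (0 : R))).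
  by rewrite (_ : mkset _ = f @^-1` (~` [set 0])) //; apply/seteqP; split=> x /= /eqP.
apply: (subset_measure0 mS mN _ N0) => x /= /eqP fx; apply: sN => /=.
by move=> /(_ Logic.I) []; exact: fx.
Qed.

End BoundedIntegral.

Lemma bdd_comp (R : realType) d d' (T : measurableType d) (U : measurableType d')
  (f : U -> R) (p : T -> U) : measurable_fun setT p -> bdd_meas f ->
  bdd_meas (fun x => f (p x)).
Proof.
by move=> mp [mf [M fM]]; split; [exact: (measurableT_comp mf mp)|exists M].
Qed.

Lemma expect_push (R : realType) d d' (T : measurableType d) (U : measurableType d')
  (m : probability T R) (m' : probability U R) (p : T -> U) (f : U -> R) :
  measurable_fun setT p ->
  (forall A, measurable A -> m (p @^-1` A) = m' A) ->
  bdd_meas f -> expect m (fun x => f (p x)) = expect m' f.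
Proof.
move=> mp law bf; congr fine.
have mf : measurable_fun setT (EFin \o f) by apply/measurable_EFinP; case: bf.
rewrite -(@eq_measure_integral _ _ _ setT m' (push_measure m mp)); last first.
  by move=> A mA _; exact: law.
rewrite integral_pushforward ?preimage_setT //.
exact: (bdd_integrable m (bdd_comp mp bf)).
Qed.

Section L1Limit.
Context (R : realType) d (T : measurableType d) (m : probability T R).

Lemma limn_esup_le_from (u : nat -> \bar R) (N : nat) (a : \bar R) :
  (forall n, (N <= n)%N -> (u n <= a)%E) -> (limn_esup u <= a)%E.
Proof.
move=> ua; apply: (@le_trans _ _ (ereal_sup [set u x | x in [set n | (N <= n)%N]])).
  apply: ereal_inf_lbound; exists [set n | (N <= n)%N] => //.
  by exists N.
by apply: ge_ereal_sup => _ [n Nn <-]; exact: ua.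
Qed.

Lemma limn_esup_ge_from (u : nat -> \bar R) (N : nat) (a : \bar R) :
  (forall n, (N <= n)%N -> (a <= u n)%E) -> (a <= limn_esup u)%E.
Proof.
move=> ua; apply: le_ereal_inf_tmp => _ [V [M _ MV] <-].
apply: le_ereal_sup_tmp; exists (u (maxn M N)).
  by exists (maxn M N) => //; apply: MV; exact: leq_maxl.
by apply: ua; exact: leq_maxr.
Qed.

(* The limit is taken as a pointwise limsup, so that the tail sums of the
   increments bound the error everywhere, without any almost-everywhere argument. *)
Lemma L1_limit (f : nat -> T -> R) (b : nat -> R) :
  (forall n, measurable_fun setT (f n)) -> (forall n x, 0 <= f n x <= 1) ->
  (forall N M, \sum_(0 <= k < M)
     expect m (fun x => `|f (N + k).+1 x - f (N + k)%N x|) <= b N) ->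
  exists h : T -> R, [/\ measurable_fun setT h, (forall x, 0 <= h x <= 1) &
    forall N, expect m (fun x => `|f N x - h x|) <= b N].
Proof.
move=> mf f01 fb.
pose H x : \bar R := limn_esup (fun n => (f n x)%:E).
have H01 x : (0%:E <= H x <= 1%:E)%E.
  apply/andP; split.
    by apply: (@limn_esup_ge_from _ 0%N) => n _; rewrite lee_fin; case/andP: (f01 n x).
  by apply: (@limn_esup_le_from _ 0%N) => n _; rewrite lee_fin; case/andP: (f01 n x).
have HE x : (fine (H x))%:E = H x.
  apply: fineK; rewrite fin_numElt; have /andP[H0 H1] := H01 x.
  by rewrite (lt_le_trans _ H0) ?ltNyr //= (le_lt_trans H1) ?ltry.
have mH : measurable_fun setT H.
  apply: measurable_fun_limn_esup => n; exact/measurable_EFinP.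
pose h x := fine (H x).
have mh : measurable_fun setT h by exact: measurableT_comp.
have h01 x : 0 <= h x <= 1.
  by have := H01 x; rewrite -HE !lee_fin.
exists h; split=> // N.
have bf n : bdd_meas (f n) by exact: bdd_unit.
have bh : bdd_meas h by exact: bdd_unit.
pose g k x := `|f (N + k).+1 x - f (N + k)%N x|.
have bg k : bdd_meas (g k) by apply: bdd_norm; exact: bddB.
pose G x : \bar R := (\sum_(0 <= k <oo) (g k x)%:E)%E.
have mg k : measurable_fun setT (EFin \o g k).
  by apply/measurable_EFinP; case: (bg k).
have tele M x : `|f (N + M)%N x - f N x| <= \sum_(0 <= k < M) g k x.
  elim: M => [|M IH]; first by rewrite big_geq // addn0 subrr normr0.
  rewrite big_nat_recr //= addnS; apply: le_trans (lerD IH (lexx _)).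
  apply: le_trans (ler_normD _ _); rewrite le_eqVlt; apply/orP; left.
  by apply/eqP; congr `|_|; lra.
have fhG x : (`|f N x - h x|%:E <= G x)%E.
  have G0 : (0 <= G x)%E by apply: nneseries_ge0 => k _ _; rewrite lee_fin normr_ge0.
  (* An infinite tail sum bounds anything. Otherwise all later values stay within [r] of [f N x],
     and so does their limsup. *)
  case EG : (G x) G0 => [r| |] // _; last exact: leey.
  have hr M : `|f (N + M)%N x - f N x| <= r.
    rewrite -lee_fin -EG; apply: le_trans (nneseries_lim_ge M _).
      by rewrite sumEFin lee_fin; exact: tele.
    by move=> k _ _; rewrite lee_fin normr_ge0.
  have hr' n : (N <= n)%N -> `|f n x - f N x| <= r.
    by move=> /subnKC <-; exact: hr.
  have h1 : ((f N x - r)%:E <= H x)%E.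
    apply: (@limn_esup_ge_from _ N) => n /hr'; rewrite lee_fin ler_norml; lra.
  have h2 : (H x <= (f N x + r)%:E)%E.
    apply: (@limn_esup_le_from _ N) => n /hr'; rewrite lee_fin ler_norml; lra.
  rewrite lee_fin; move: h1 h2; rewrite -HE !lee_fin -/(h x) => h1 h2.
  by rewrite ler_norml; lra.
rewrite -lee_fin -expect_integral; last by apply: bdd_norm; exact: bddB.
apply: (@le_trans _ _ (\int[m]_x G x)%E).
  apply: ge0_le_integral => //.
  - by apply/measurable_EFinP; case: (bdd_norm (bddB (bf N) bh)).
  - apply: ge0_emeasurable_sum => [k x _ _|k _]; last exact: mg.
    by rewrite lee_fin normr_ge0.
rewrite integral_nneseries //; last by move=> k x _; rewrite lee_fin normr_ge0.
apply: lime_le.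
  by apply: is_cvg_nneseries => k _ _; apply: integral_ge0 => x _; rewrite lee_fin normr_ge0.
apply: nearW => M.
rewrite (eq_bigr (fun k => (expect m (g k))%:E)); last first.
  by move=> k _; rewrite expect_integral.
by rewrite sumEFin lee_fin; exact: fb.
Qed.

End L1Limit.

Lemma pow_small (R : realType) (e : R) : 0 < e -> exists n, 4^-1 ^+ n < e.
Proof.
move=> e0; have [n /(_ _ (leqnn n)) ne] := small_inv e0; exists n.
apply: le_lt_trans ne; rewrite exprVn lef_pV2 ?posrE ?exprn_gt0 ?ltr0n //.
by rewrite -natrX ler_nat ltn_expl.
Qed.

Section AlmostEverywhere.
Context (R : realType) d (T : measurableType d) (m : probability T R).

Lemma ae_forall (I : Type) (P : I -> T -> Prop) : countable [set: I] ->
  (forall i, \forall x \ae m, P i x) -> \forall x \ae m, forall i, P i x.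
Proof.
move=> cI; have [I' eI] := Pcountable cI.
subst I => h.
have := @ae_foralln _ _ _ m (fun n x => if unpickle n is Some i then P i x else True).
have h' n : \forall x \ae m, if unpickle n is Some i then P i x else True.
  by case: (unpickle n) => [i|]; [exact: h|exact: aeW].
move/(_ h'); apply: filterS => x hx i.
by have := hx (pickle i); rewrite pickleK.
Qed.

Lemma ae_null (P : T -> Prop) : measurable [set x | P x] ->
  m (~` [set x | P x]) = 0%E -> \forall x \ae m, P x.
Proof. by move=> mP P0; exists (~` [set x | P x]); split=> //; exact: measurableC. Qed.

Lemma ae_exists (P : T -> Prop) : (\forall x \ae m, P x) -> exists x, P x.
Proof.
move=> [N [mN N0 sN]]; apply: contrapT => nP.
have : m setT = 0%E.
  apply: (subset_measure0 measurableT mN _ N0) => x _; apply: sN => Px.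
  by apply: nP; exists x.
by rewrite probability_setT => /eqP; rewrite onee_eq0.
Qed.

Lemma expect_ae (f g : T -> R) : bdd_meas f -> bdd_meas g ->
  (\forall x \ae m, f x = g x) -> expect m f = expect m g.
Proof.
move=> bf bg fg; congr fine; apply: ae_eq_integral => //.
- by apply/measurable_EFinP; case: bf.
- by apply/measurable_EFinP; case: bg.
- by apply: filterS fg => x fgx _; rewrite /= fgx.
Qed.

Lemma ae_of_expect0 (f g : T -> R) : bdd_meas f -> bdd_meas g ->
  expect m (fun x => `|f x - g x|) = 0 -> \forall x \ae m, f x = g x.
Proof.
move=> bf bg /(expect0_ae (bddB bf bg)) fg0.
exists [set x | f x - g x != 0]; split=> //.
  rewrite (_ : mkset _ = (fun x => f x - g x) @^-1` (~` [set 0])).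
    by apply: (measurable_preimage (bddB bf bg).1); apply: measurableC.
  by apply/seteqP; split=> x /= /eqP.
by move=> x /= fgx; apply/eqP => /subr0_eq.
Qed.

End AlmostEverywhere.

Section MeanErgodic.
Context (R : realType) (G : groupType) d (T : measurableType d).
Context (act : G -> T -> T).
Hypothesis (bact : borel_action act).

(** Dyadic convex combinations of translates of the indicator. A general group need not be amenable,
    so there is no canonical sequence of averages; one minimizes over this whole set, whose closure
    under midpoints is what the parallelogram identity asks for. *)
Inductive orbit_avg (A : set T) : (T -> R) -> Prop :=
| OrbitIndic g : orbit_avg A (fun y => \1_A (act g y))
| OrbitMid f f' : orbit_avg A f -> orbit_avg A f' ->
    orbit_avg A (fun y => 2^-1 * (f y + f' y)).

Variable A : set T.
Hypothesis mA : measurable A.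

Lemma orbit_avg_unit f : orbit_avg A f ->
  measurable_fun setT f /\ forall y, 0 <= f y <= 1.
Proof.
elim=> [g|{}f f' _ [mf f01] _ [mf' f'01]].
  split; first exact: (measurableT_comp (measurable_indic mA) (bact.2 g)).
  by move=> y; rewrite indicE; case: (_ \in _); rewrite ?ler01 ?lexx.
split; first by apply: measurable_funM => //; exact: measurable_funD.
by move=> y; have := f01 y; have := f'01 y; lra.
Qed.

Lemma orbit_avg_bdd f : orbit_avg A f -> bdd_meas f.
Proof. by case/orbit_avg_unit => mf f01; exact: bdd_unit. Qed.

Lemma orbit_avg_act g f : orbit_avg A f -> orbit_avg A (fun y => f (act g y)).
Proof.
elim=> [h|{}f f' _ IH _ IH']; last exact: OrbitMid.
rewrite (_ : (fun y => _) = (fun y => \1_A (act (h * g)%g y))).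
  exact: OrbitIndic.
by apply/funext => y; rewrite bact.1.2.
Qed.

Lemma expect_act (m : probability T R) g (f : T -> R) : mp_action m act ->
  bdd_meas f -> expect m (fun y => f (act g y)) = expect m f.
Proof. by move=> mp; apply: expect_push; [exact: bact.2|exact: mp]. Qed.

(** The measure is quantified in the statement: the averages are fixed functions, later integrated
    against [m] and against its ergodic components. *)
Lemma orbit_avg_expect (m : probability T R) (J : set T) f : mp_action m act ->
  measurable J -> (forall g, act g @^-1` J = J) -> orbit_avg A f ->
  expect m (fun y => \1_J y * f y) = fine (m (A `&` J)).
Proof.
move=> mp mJ iJ; have bJ := bdd_indic R mJ.
elim=> [g|{}f f' hf IH hf' IH'].
  have bAJ := bdd_indic R (measurableI _ _ mA mJ).
  rewrite -(expect_indic m (measurableI _ _ mA mJ)) /= -(expect_act g mp bAJ).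
  apply: eq_expect => y; rewrite -{1}(iJ g) !indicE in_setI mulrC.
  by rewrite -[y \in _ @^-1` _]/(act g y \in J); case: (_ \in A); case: (_ \in J);
    rewrite /= ?mulr1 ?mulr0.
have b := orbit_avg_bdd hf; have b' := orbit_avg_bdd hf'.
transitivity (expect m (fun y => 2^-1 * (\1_J y * f y + \1_J y * f' y))).
  by apply: eq_expect => y; lra.
rewrite expectZ ?expectD ?IH ?IH' //; first lra.
- exact: bddM.
- exact: bddM.
- by apply: bddD; exact: bddM.
Qed.

Section Convergence.
Hypothesis cG : countable_group G.
Variable m : probability T R.
Hypothesis mp : mp_action m act.

Let q (f : T -> R) := expect m (fun y => f y * f y).
Let alpha := inf [set q f | f in orbit_avg A].

Let q_ge f : orbit_avg A f -> alpha <= q f.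
Proof.
move=> hf; apply: ge_inf; last by exists f.
by exists 0 => _ [f' _ <-]; apply: expect_ge0 => y; rewrite -expr2 sqr_ge0.
Qed.

Let avg_exists e : 0 < e -> exists2 f, orbit_avg A f & q f <= alpha + e.
Proof.
move=> e0; have [|_ [f hf <-] fe] := @inf_adherent R [set q f | f in orbit_avg A] e e0.
  split.
    by exists (q (fun y => \1_A (act 1%g y))), (fun y => \1_A (act 1%g y)) => //; exact: OrbitIndic.
  by exists 0 => _ [f' _ <-]; apply: expect_ge0 => y; rewrite -expr2 sqr_ge0.
by exists f => //; exact: ltW.
Qed.

(* Parallelogram identity: the midpoint again belongs to the convex set, so two
   near-minimizers of the L2 norm are L2-close, hence L1-close. *)
Let near_min (c : R) f f' : 0 < c -> orbit_avg A f -> orbit_avg A f' ->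
  q f <= alpha + c ^+ 2 -> q f' <= alpha + c ^+ 2 ->
  expect m (fun y => `|f y - f' y|) <= 3 * c.
Proof.
move=> c0 hf hf' qf qf'.
have b := orbit_avg_bdd hf; have b' := orbit_avg_bdd hf'.
have bb := bddM b b; have bb' := bddM b' b'.
have bm := orbit_avg_bdd (OrbitMid hf hf').
have bd := bddB b b'; have bdd := bddM bd bd.
have qd : q (fun y => f y - f' y) <= 4 * c ^+ 2.
  have -> : q (fun y => f y - f' y) =
      2 * q f + 2 * q f' - 4 * q (fun y => 2^-1 * (f y + f' y)).
    have b1 := bddZ 2 bb; have b2 := bddZ 2 bb'; have bmm := bddM bm bm.
    have := expectB m (bddD b1 b2) (bddZ 4 bmm).
    rewrite (expectD m b1 b2) (expectZ m 2 bb) (expectZ m 2 bb') (expectZ m 4 bmm).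
    rewrite /q => <-.
    by apply: eq_expect => y; field.
  by have := q_ge (OrbitMid hf hf'); lra.
(* From [(u - c)^2 >= 0] one gets [u <= u^2 / (2c) + c/2], which turns the L2 bound [4 c^2] into the
   L1 bound [2c + c/2], below [3c]. *)
apply: (@le_trans _ _ (expect m (fun y =>
    (2 * c)^-1 * ((f y - f' y) * (f y - f' y)) + 2^-1 * c))).
  apply: expect_le; [exact: bdd_norm|exact: bddD (bddZ _ bdd) (bdd_cst T _)|].
  move=> y; rewrite -expr2 -real_normK ?num_real //; set u := `|_|.
  rewrite -(ler_pM2l (x := 2 * c)); last lra.
  rewrite mulrDr mulVKf ?gt_eqF //; last lra.
  by have := sqr_ge0 (u - c); rewrite sqrrB; lra.
rewrite (expectD m (bddZ _ bdd) (bdd_cst T _)) (expectZ m _ bdd) expect_cst.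
have : (2 * c)^-1 * q (fun y => f y - f' y) <= (2 * c)^-1 * (4 * c ^+ 2).
  by rewrite ler_pM2l // invr_gt0; lra.
have -> : (2 * c)^-1 * (4 * c ^+ 2) = 2 * c by field; rewrite gt_eqF.
rewrite /q; lra.
Qed.

(** The limit is the element of least L2 norm in the closed hull of the translates. A translate of a
    near-minimizer is again a near-minimizer, so [near_min] makes the limit invariant almost
    everywhere; a correction on a null set makes it invariant everywhere. *)
Theorem mean_ergodic : exists (f : nat -> T -> R) (h : T -> R),
  [/\ forall n, orbit_avg A (f n), measurable_fun setT h,
      forall y, 0 <= h y <= 1, forall g y, h (act g y) = h y &
      forall n, expect m (fun y => `|f n y - h y|) <= 4 * 4^-1 ^+ n].
Proof.
(* With ratio 1/4, [3 c k = 4 c k - 4 c k.+1], so the increments telescope to at most [4 c N]. *)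
pose c n : R := 4^-1 ^+ n.
have c0 n : 0 < c n by rewrite exprn_gt0.
have cS n : c n.+1 = 4^-1 * c n by rewrite /c exprS.
have [f hf] : exists f : nat -> T -> R, forall n,
    orbit_avg A (f n) /\ q (f n) <= alpha + c n ^+ 2.
  have /choice[f hf] : forall n, exists f, orbit_avg A f /\ q f <= alpha + c n ^+ 2.
    move=> n; have [|f hf qf] := @avg_exists (c n ^+ 2); first by rewrite exprn_gt0.
    by exists f.
  by exists f.
have df n : expect m (fun y => `|f n.+1 y - f n y|) <= 3 * c n.
  apply: near_min => //; try by case: (hf n); case: (hf n.+1).
  apply: le_trans (hf n.+1).2 _; rewrite lerD2l ler_sqr ?nnegrE ?ltW // cS.
  by have := c0 n; lra.
have [H [mH H01 fH]] : exists h : T -> R, [/\ measurable_fun setT h,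
    (forall x, 0 <= h x <= 1) &
    forall N, expect m (fun x => `|f N x - h x|) <= 4 * c N].
  apply: L1_limit => [n|n|N M].
  - by case: (orbit_avg_unit (hf n).1).
  - by case: (orbit_avg_unit (hf n).1).
  suff : \sum_(0 <= k < M) expect m (fun x => `|f (N + k).+1 x - f (N + k)%N x|)
      <= 4 * c N - 4 * c (N + M)%N by have := c0 (N + M)%N; lra.
  elim: M => [|M IH]; first by rewrite big_geq // addn0 subrr.
  rewrite big_nat_recr //= addnS cS.
  by have := df (N + M)%N; lra.
have bH : bdd_meas H by exact: bdd_unit.
have bf n : bdd_meas (f n) by exact: orbit_avg_bdd (hf n).1.
have Hinv g : \forall y \ae m, H (act g y) = H y.
  have bHg := bdd_comp (bact.2 g) bH.
  apply: ae_of_expect0 => //.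
  apply/eqP; rewrite eq_le expect_ge0 ?andbT //.
  (* 11 = 4 + 3 + 4: [f n] is close to [H] at both points, and close to its own translate. *)
  have le11 n : expect m (fun y => `|H (act g y) - H y|) <= 11 * c n.
    have bfg := bdd_comp (bact.2 g) (bf n).
    have b1 := bdd_norm (bddB bfg bHg).
    have b2 := bdd_norm (bddB bfg (bf n)).
    have b3 := bdd_norm (bddB (bf n) bH).
    apply: (@le_trans _ _ (expect m (fun y => `|f n (act g y) - H (act g y)|
      + `|f n (act g y) - f n y| + `|f n y - H y|))).
      apply: expect_le; [exact: bdd_norm (bddB bHg bH)|by apply: bddD => //; exact: bddD|].
      move=> y; have := ler_normD (H (act g y) - f n (act g y)) (f n (act g y) - H y).
      have := ler_normD (f n (act g y) - f n y) (f n y - H y).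
      by rewrite !subrKA (distrC _ (f n (act g y))); lra.
    rewrite !expectD //; last exact: bddD.
    have e1 : expect m (fun y => `|f n (act g y) - H (act g y)|) <= 4 * c n.
      by rewrite (expect_act (f := fun y => `|f n y - H y|) g mp b3).
    have e2 : expect m (fun y => `|f n (act g y) - f n y|) <= 3 * c n.
      apply: near_min => //; try by case: (hf n).
        exact: orbit_avg_act (hf n).1.
      rewrite /q (expect_act (f := fun y => f n y * f n y) g mp (bddM (bf n) (bf n))).
      by case: (hf n).
    have := fH n; lra.
  apply/ler_addgt0Pr => e e0; rewrite add0r.
  have [n ne] := pow_small (divr_gt0 e0 (ltr0n R 11)).
  by apply: le_trans (le11 n) _; rewrite -/(c n) in ne; lra.
(* The set of points whose whole orbit carries one value of [H] is conull, Borel and itself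
   invariant, so setting the function to 0 outside it gives strict invariance. *)
pose U y := forall g, H (act g y) = H y.
have mU : measurable [set y | U y].
  apply: measurable_forall => // g.
  rewrite (_ : mkset _ = (fun y => H (act g y) - H y) @^-1` [set 0]).
    apply: (measurable_preimage (bddB (bdd_comp (bact.2 g) bH) bH).1) => //.
  apply/seteqP; split=> y /=; first by move=> ->; rewrite subrr.
  exact: subr0_eq.
have aU : \forall y \ae m, U y by exact: (ae_forall cG Hinv).
have Uact g y : U (act g y) <-> U y.
  have ag g1 g2 z : act g1 (act g2 z) = act (g1 * g2)%g z by rewrite bact.1.2.
  split=> h k.
    have h1 : forall k', H (act k' y) = H (act g y).
      by move=> k'; have := h (k' * g^-1)%g; rewrite ag -mulgA mulVg mulg1.
    by rewrite h1 -(h1 1%g) bact.1.1.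
  by rewrite ag !h.
pose h y := if `[< U y >] then H y else 0.
have mh : measurable_fun setT h.
  apply: measurable_fun_ifT => //.
  by apply: (@measurable_fun_bool _ _ _ _ true); rewrite setTI;
    apply: (dmeas_bool mU [set true]).
exists f, h; split=> //.
- by move=> n; case: (hf n).
- by move=> y; rewrite /h; case: asboolP; rewrite ?lexx ?ler01.
- move=> g y; rewrite /h; case: asboolP => [/Uact h1|h1]; case: asboolP => h2 //.
    by case: h1; apply/Uact.
- move=> n; rewrite (_ : expect m _ = expect m (fun y => `|f n y - H y|)) //.
  apply: expect_ae.
  + apply: bdd_norm; apply: bddB => //; apply: bdd_unit => // y.
    by rewrite /h; case: asboolP; rewrite ?lexx ?ler01.
  + exact: bdd_norm (bddB (bf n) bH).
  by apply: filterS aU => y Uy; rewrite /h asboolT.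
Qed.

End Convergence.
End MeanErgodic.

(** * Ergodic decomposition *)

Lemma expect_prod (R : realType) d1 d2 (T1 : measurableType d1)
  (T2 : measurableType d2) (P1 : probability T1 R) (P2 : probability T2 R)
  (F : T1 * T2 -> R) : bdd_meas F ->
  bdd_meas (fun y => expect P2 (fun t => F (y, t))) /\
  expect P1 (fun y => expect P2 (fun t => F (y, t))) = expect (P1 \x P2)%E F.
Proof.
move=> bF; have [mF [M FM]] := bF.
have bs y : bdd_meas (fun t => F (y, t)) by exact: (bdd_comp (pair1_measurable y) bF).
have iF := bdd_integrable (P1 \x P2)%E bF.
have FE y : fubini_F P2 (EFin \o F) y = (expect P2 (fun t => F (y, t)))%:E.
  by rewrite -expect_integral.
have bE : bdd_meas (fun y => expect P2 (fun t => F (y, t))).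
  split; last first.
    exists M => y; apply: le_trans (expect_norm P2 (bs y)) _.
    rewrite -[leRHS](expect_cst P2 M); apply: expect_le => //.
      exact: bdd_norm.
    exact: bdd_cst.
  have := measurable_fubini_F iF.
  rewrite (_ : fubini_F _ _ = EFin \o (fun y => expect P2 (fun t => F (y, t)))).
    by move/measurable_EFinP.
  by apply/funext => y; rewrite FE.
split=> //; apply: EFin_inj; rewrite -!expect_integral //.
rewrite -(integral12_prod_meas1 iF); apply: eq_integral => y _.
by rewrite FE.
Qed.

Section Invariant.
Context (R : realType) (G : groupType) d (T : measurableType d).
Context (act : G -> T -> T) (m : probability T R).

Definition inv_set (J : set T) := measurable J /\ forall g, act g @^-1` J = J.

(** The sets where one function exceeds the other are themselves invariant, and testing on these two
    recovers the integral of [|u - v|]. This is uniqueness of conditional expectations. *)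
Lemma ae_eq_invariant (u v : T -> R) : bdd_meas u -> bdd_meas v ->
  (forall g y, u (act g y) = u y) -> (forall g y, v (act g y) = v y) ->
  (forall J, inv_set J ->
    expect m (fun y => \1_J y * u y) = expect m (fun y => \1_J y * v y)) ->
  \forall y \ae m, u y = v y.
Proof.
move=> bu bv iu iv uv; apply: ae_of_expect0 => //.
pose J1 := [set y | v y < u y]; pose J2 := [set y | u y < v y].
have mlt (f f' : T -> R) : bdd_meas f -> bdd_meas f' -> measurable [set y | f y < f' y].
  move=> bf bf'; rewrite (_ : mkset _ = (fun y => f' y - f y) @^-1` `]0, +oo[%classic).
    by apply: (measurable_preimage (bddB bf' bf).1); exact: measurable_itv.
  by apply/seteqP; split=> y; rewrite /= in_itv /= andbT subr_gt0.
have J1i : inv_set J1.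
  split; first exact: mlt.
  by move=> g; apply/seteqP; split=> y; rewrite /J1 /= iu iv.
have J2i : inv_set J2.
  split; first exact: mlt.
  by move=> g; apply/seteqP; split=> y; rewrite /J2 /= iu iv.
have b1 := bdd_indic R J1i.1; have b2 := bdd_indic R J2i.1.
have -> : expect m (fun y => `|u y - v y|) =
    expect m (fun y => (\1_J1 y * u y - \1_J1 y * v y) +
                       (\1_J2 y * v y - \1_J2 y * u y)).
  apply: eq_expect => y; rewrite !indicE.
  have -> : (y \in J1) = (v y < u y) by apply/idP/idP; rewrite inE.
  have -> : (y \in J2) = (u y < v y) by apply/idP/idP; rewrite inE.
  case: (ltgtP (u y) (v y)) => h /=.
  - by rewrite ltr0_norm ?subr_lt0 //; lra.
  - by rewrite gtr0_norm ?subr_gt0 //; lra.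
  - by rewrite h subrr normr0; lra.
rewrite (expectD m (bddB (bddM b1 bu) (bddM b1 bv)) (bddB (bddM b2 bv) (bddM b2 bu))).
rewrite (expectB m (bddM b1 bu) (bddM b1 bv)) (expectB m (bddM b2 bv) (bddM b2 bu)).
by rewrite (uv _ J1i) (uv _ J2i); lra.
Qed.

(** By Markov's inequality, the set where all [U n] are at least [e] has measure at most
    [C * 4^-n / e] for every [n], hence 0. *)
Lemma ae_small (U : nat -> T -> R) (C : R) : (forall n, bdd_meas (U n)) ->
  (forall n y, 0 <= U n y) -> (forall n, expect m (U n) <= C * 4^-1 ^+ n) ->
  \forall y \ae m, forall e, 0 < e -> exists n, U n y < e.
Proof.
move=> bU U0 UC.
suff h k : \forall y \ae m, exists n, U n y < k.+1%:R^-1.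
  apply: filterS (ae_forall (countableP _) h) => y hy e e0.
  have [k /(_ _ (leqnn k)) ke] := small_inv e0.
  by have [n Un] := hy k; exists n; exact: lt_trans ke.
set e : R := _^-1; have e0 : 0 < e by rewrite invr_gt0 ltr0n.
pose S := [set y | exists n, U n y < e].
have mS : measurable S.
  apply: measurable_exists => // n.
  rewrite (_ : mkset _ = U n @^-1` `]-oo, e[%classic).
    by apply: (measurable_preimage (bU n).1); exact: measurable_itv.
  by apply/seteqP; split=> y; rewrite /= in_itv.
have mCS := measurableC mS.
have bS := bdd_indic R mCS.
apply: ae_null => //; rewrite -(expect_indic m mCS); congr EFin.
have E0 : 0 <= expect m (\1_(~` S) : T -> R).
  by apply: expect_ge0 => y; rewrite indicE.
apply/eqP; rewrite eq_le E0 andbT; apply/ler_addgt0Pr => r r0; rewrite add0r.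
(* [|C| + 1] is a bound for [C] by which one can divide. *)
have C1 : 0 < `|C| + 1 by have := normr_ge0 C; lra.
have [n ne] := pow_small (divr_gt0 (mulr_gt0 r0 e0) C1).
have h1 : e * expect m (\1_(~` S) : T -> R) <= C * 4^-1 ^+ n.
  apply: le_trans (UC n); rewrite -(expectZ m _ bS); apply: expect_le => //.
    exact: bddZ.
  move=> y; rewrite indicE; case: (boolP (y \in _)); rewrite ?mulr0 ?mulr1 //.
  rewrite inE => /= h; rewrite leNgt; apply/negP => Un; apply: h; by exists n.
have h2 : C * 4^-1 ^+ n <= (`|C| + 1) * 4^-1 ^+ n.
  rewrite ler_pM2r ?exprn_gt0 //; have := ler_norm C; lra.
move: ne; rewrite ltr_pdivlMr // => ne.
rewrite -(ler_pM2l e0); nra.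
Qed.

End Invariant.

Section Decomposition.
Context (R : realType) (G : groupType) d (T : measurableType d).
Context (act : G -> T -> T) (m : probability T R).
Hypothesis cG : countable_group G.
Hypothesis bact : borel_action act.
Hypothesis mp : mp_action m act.
Variables (phi : T -> cantor) (psi : cantor -> T).
Hypothesis mphi : measurable_fun setT phi.
Hypothesis mpsi : measurable_fun setT psi.
Hypothesis phiK : cancel phi psi.
Variable lam : probability (measurableTypeR R) R.
Hypothesis lam_itv : forall a b : R,
  0 <= a -> a <= b -> b <= 1 -> lam `[a, b[%classic = (b - a)%:E.

Let A s := phi @^-1` cylinder s.
Let mA s : measurable (A s).
Proof. exact: (measurable_preimage mphi (measurable_cylinder s)). Qed.

Variables (f : seq bool -> nat -> T -> R) (h : seq bool -> T -> R).
Hypothesis avgf : forall s n, orbit_avg act (A s) (f s n).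
Hypothesis mh : forall s, measurable_fun setT (h s).
Hypothesis h01 : forall s y, 0 <= h s y <= 1.
Hypothesis hact : forall s g y, h s (act g y) = h s y.
Hypothesis fh : forall s n, expect m (fun y => `|f s n y - h s y|) <= 4 * 4^-1 ^+ n.

Let bh s : bdd_meas (h s). Proof. exact: bdd_unit. Qed.
Let bf s n : bdd_meas (f s n). Proof. exact: (orbit_avg_bdd bact (mA s)). Qed.

(* [h s] is the conditional expectation of the indicator of [A s] given the invariant
   sets. *)
Lemma expect_cond s J : inv_set act J ->
  expect m (fun y => \1_J y * h s y) = fine (m (A s `&` J)).
Proof.
move=> [mJ iJ]; have bJ := bdd_indic R mJ.
apply/eqP; rewrite -subr_eq0 -normr_eq0 eq_le normr_ge0 andbT.
apply/ler_addgt0Pr => e e0; rewrite add0r.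
have [n ne] := pow_small (divr_gt0 e0 (ltr0n R 4)).
rewrite -(orbit_avg_expect bact (mA s) mp mJ iJ (avgf s n)).
rewrite -(expectB m (bddM bJ (bh s)) (bddM bJ (bf s n))).
apply: le_trans (expect_norm _ (bddB (bddM bJ (bh s)) (bddM bJ (bf s n)))) _.
apply: (@le_trans _ _ (4 * 4^-1 ^+ n)); last lra.
apply: le_trans (fh s n); apply: expect_le.
- exact: (bdd_norm (bddB (bddM bJ (bh s)) (bddM bJ (bf s n)))).
- exact: (bdd_norm (bddB (bf s n) (bh s))).
- move=> y; rewrite indicE -mulrBr normrM distrC.
  by case: (_ \in _); rewrite /= ?normr1 ?normr0 ?mul1r ?mul0r.
Qed.

Let additive_at y := h [::] y = 1 /\
  forall s, h s y = h (true :: s) y + h (false :: s) y.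

Let madd : measurable [set y | additive_at y].
Proof.
have meq (u v : T -> R) : bdd_meas u -> bdd_meas v -> measurable [set y | u y = v y].
  move=> bu bv; rewrite (_ : mkset _ = (fun y => u y - v y) @^-1` [set 0]).
    by apply: (measurable_preimage (bddB bu bv).1).
  by apply/seteqP; split=> y /=; [move=> ->; rewrite subrr|exact: subr0_eq].
apply: measurableI; first exact: (meq _ _ (bh _) (bdd_cst T 1)).
by apply: measurable_forall => // s; exact: (meq _ _ (bh _) (bddD (bh _) (bh _))).
Qed.

Let additive_act g y : additive_at (act g y) <-> additive_at y.
Proof.
split=> -[h1 hs]; split.
- by rewrite -h1 hact.
- by move=> s; have := hs s; rewrite !hact.
- by rewrite hact.
- by move=> s; rewrite !hact.
Qed.

Let additive_ae : \forall y \ae m, additive_at y.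
Proof.
have h1 : \forall y \ae m, h [::] y = 1.
  apply: (@ae_eq_invariant R G d T act m _ _ (bh [::]) (bdd_cst T 1)) => //.
  move=> J [mJ iJ]; rewrite expect_cond //.
  rewrite (_ : A [::] = setT) ?setTI; last by apply/seteqP; split.
  transitivity (expect m (\1_J : T -> R)); first by rewrite -(expect_indic m mJ).
  by apply: eq_expect => y; rewrite mulr1.
have hD s : \forall y \ae m, h s y = h (true :: s) y + h (false :: s) y.
  apply: (@ae_eq_invariant R G d T act m _ _ (bh s) (bddD (bh _) (bh _))) => //.
    by move=> g y; rewrite !hact.
  move=> J iJ; have [mJ _] := iJ; have bJ := bdd_indic R mJ.
  rewrite (expect_cond s iJ).
  transitivity (expect m (fun y => \1_J y * h (true :: s) y + \1_J y * h (false :: s) y));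
    last by apply: eq_expect => y; rewrite mulrDr.
  rewrite (expectD m (bddM bJ (bh _)) (bddM bJ (bh _))) !expect_cond //.
  rewrite {1}/A cylinder_split preimage_setU setIUl measureU.
  - by rewrite fineD // fin_num_measure //; apply: measurableI => //; exact: mA.
  - by apply: measurableI => //; exact: mA.
  - by apply: measurableI => //; exact: mA.
  - by apply/seteqP; split=> x //= [] [[+ _] _] [[+ _] _] => ->.
by apply: filterS2 h1 (ae_forall (countableP _) hD).
Qed.

(* On the null set where the conditional expectations fail to be additive, the weights
   of [m] serve as a default. *)
Let w y s : R := if `[< additive_at y >] then h s y else fine (m (A s)).

Let ww y : weight (w y).
Proof.
rewrite /w; case: asboolP => [[h1 hD]|_]; last exact: (prob_weight m mphi).
by split=> // s; case/andP: (h01 s y).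
Qed.

Let mw s : measurable_fun setT (fun y => w y s).
Proof.
apply: measurable_fun_ifT => //.
by apply: (@measurable_fun_bool _ _ _ _ true); rewrite setTI;
  exact: (dmeas_bool madd [set true]).
Qed.

Let wact g y : w (act g y) = w y.
Proof.
apply/funext => s; rewrite /w hact.
by have -> : `[< additive_at (act g y) >] = `[< additive_at y >]
  by apply/asboolP/asboolP => /additive_act.
Qed.

Let wh : \forall y \ae m, forall s, w y s = h s y.
Proof. by apply: filterS additive_ae => y hy s; rewrite /w asboolT. Qed.

Let code (p : T * measurableTypeR R) : cantor := split_code (w p.1) p.2.
Let mcode : measurable_fun setT code. Proof. exact: measurable_split_code. Qed.
Let Psi p := psi (code p).
Let mPsi : measurable_fun setT Psi. Proof. exact: measurableT_comp. Qed.

(** The ergodic component at [y]: the conditional distribution of a point given the invariant sets,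
    realized as the law of [Psi (y, t)] for uniform [t]. *)
Definition kappa y : probability T R :=
  push_prob lam (measurableT_comp mPsi (pair1_measurable y)).

Let kappa_act g y B : kappa (act g y) B = kappa y B.
Proof.
transitivity (lam ((fun t => Psi (act g y, t)) @^-1` B)); first by [].
transitivity (lam ((fun t => Psi (y, t)) @^-1` B)); last by [].
by congr (lam _); apply/seteqP; split=> t; rewrite /= /Psi /code /= wact.
Qed.

Let joint_code s J : inv_set act J ->
  (m \x lam)%E (code @^-1` cylinder s `&` (J `*` setT)) = m (A s `&` J).
Proof.
move=> iJ; have [mJ _] := iJ.
have mc : measurable (code @^-1` cylinder s).
  exact: (measurable_preimage mcode (measurable_cylinder s)).
have bw : bdd_meas (fun y => w y s).
  apply: bdd_unit => [|y]; first exact: mw.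
  rewrite /w; case: asboolP => // _; rewrite fine_ge0 //=.
  by rewrite -lee_fin fineK ?fin_num_measure //; exact: probability_le1.
transitivity (expect m (fun y => \1_J y * w y s))%:E.
  rewrite -(expect_integral m (bddM (bdd_indic R mJ) bw)).
  apply: eq_integral => y _ /=; rewrite xsectionI.
  rewrite indicE; case: (boolP (y \in J)) => yJ; last first.
    by rewrite notin_xsectionX // setI0 measure0 mul0r.
  rewrite in_xsectionX // setIT mul1r.
  rewrite -(split_code_law lam_itv (ww y) (s := s)).
    by congr (lam _); apply/seteqP; split=> t; rewrite /xsection /= inE.
  have := measurable_xsection y mc; congr (measurable _).
  by apply/seteqP; split=> t; rewrite /xsection /= inE.
have -> : expect m (fun y => \1_J y * w y s) = expect m (fun y => \1_J y * h s y).
  have bJ := bdd_indic R mJ; apply: expect_ae; try exact: bddM.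
  by apply: filterS wh => y ->.
by rewrite expect_cond // fineK // fin_num_measure //; apply: measurableI => //; exact: mA.
Qed.

(** Disintegration: drawing [y] from [m] and then a point from [kappa y] gives law [m], and an
    invariant event about [y] may be read as the same event about the point. Both sides are finite
    measures in [B], so cylinders suffice. *)
Lemma joint_law B J : measurable B -> inv_set act J ->
  (m \x lam)%E (Psi @^-1` B `&` (J `*` setT)) = m (B `&` J).
Proof.
move=> mB iJ; have [mJ _] := iJ.
have mJT : measurable (J `*` [set: measurableTypeR R]) by exact: measurableX.
have -> : B = phi @^-1` (psi @^-1` B).
  by apply/seteqP; split=> x; rewrite /= phiK.
have -> : Psi @^-1` (phi @^-1` (psi @^-1` B)) = code @^-1` (psi @^-1` B).
  by apply/seteqP; split=> x; rewrite /Psi /= phiK.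
have := @cylinder_measure_unique R (push_measure (mrestr (m \x lam)%E mJT) mcode)
  (push_measure (mrestr m mJ) mphi) _ _ (psi @^-1` B).
apply.
- apply: (@le_lt_trans _ _ 1%E); last exact: ltry.
  suff : ((m \x lam)%E (code @^-1` setT `&` (J `*` setT)) <= 1)%E by [].
  by rewrite preimage_setT setTI; exact: probability_le1.
- by move=> s; exact: joint_code.
- exact: measurable_preimage.
Qed.

Let inv_setT : inv_set act setT. Proof. by split. Qed.

Lemma kappa_expect (u : T -> R) : bdd_meas u ->
  bdd_meas (fun y => expect (kappa y) u) /\
  expect m (fun y => expect (kappa y) u) = expect m u.
Proof.
move=> bu; have bF := bdd_comp mPsi bu.
have kE y : expect (kappa y) u = expect lam (fun t => u (Psi (y, t))).
  apply/esym/expect_push => //.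
  exact: (measurableT_comp mPsi (pair1_measurable y)).
have -> : (fun y => expect (kappa y) u) = (fun y => expect lam (fun t => u (Psi (y, t)))).
  by apply/funext.
have [bE ->] := expect_prod m lam bF; split=> //.
apply: expect_push => // B mB.
by have := joint_law mB inv_setT; rewrite setXTT !setIT.
Qed.

Lemma kappa_bdd B : measurable B -> bdd_meas (fun y => fine (kappa y B)).
Proof.
move=> mB; have [bE _] := kappa_expect (bdd_indic R mB).
by have -> : (fun y => fine (kappa y B)) = (fun y => expect (kappa y) (\1_B))
  by apply/funext => y; rewrite -(expect_indic (kappa y) mB).
Qed.

Lemma kappa_cond B J : measurable B -> inv_set act J ->
  expect m (fun y => \1_J y * fine (kappa y B)) = fine (m (B `&` J)).
Proof.
move=> mB iJ; have [mJ _] := iJ.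
pose E := Psi @^-1` B `&` (J `*` [set: measurableTypeR R]).
have mE : measurable E.
  by apply: measurableI; [exact: measurable_preimage|exact: measurableX].
rewrite -(joint_law mB iJ) -/E -(expect_indic (m \x lam)%E mE) /=.
have [_ <-] := expect_prod m lam (bdd_indic R mE).
apply: eq_expect => y.
have bBy : bdd_meas (fun t => \1_B (Psi (y, t)) : R).
  exact: (bdd_comp (measurableT_comp mPsi (pair1_measurable y)) (bdd_indic R mB)).
have -> : fine (kappa y B) = expect lam (fun t => \1_B (Psi (y, t)) : R).
  rewrite -(expect_indic (kappa y) mB) /=; apply/esym/expect_push => //.
    exact: (measurableT_comp mPsi (pair1_measurable y)).
  exact: bdd_indic.
rewrite -(expectZ lam _ bBy); apply: eq_expect => t.
rewrite !indicE in_setI in_setX /= in_setT andbT.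
have -> : ((y, t) \in Psi @^-1` B) = (Psi (y, t) \in B) by apply/idP/idP; rewrite !inE.
by case: (y \in J); case: (_ \in B); rewrite /= ?mulr1 ?mulr0.
Qed.

Lemma kappa_code : \forall y \ae m, forall s, fine (kappa y (A s)) = h s y.
Proof.
apply: (ae_forall (countableP _)) => s.
apply: (@ae_eq_invariant R G d T act m _ _ (kappa_bdd (mA s)) (bh s)) => //.
- by move=> g y; rewrite kappa_act.
- by move=> J iJ; rewrite kappa_cond // expect_cond.
Qed.

(** For each of countably many pairs [g], [s], invariance of [m] gives [A s] and its preimage under
    [act g] the same conditional expectation; agreement on cylinders then gives invariance on all
    sets. *)
Lemma kappa_invariant : \forall y \ae m, mp_action (kappa y) act.
Proof.
have H : \forall y \ae m, forall g s,
    fine (kappa y (act g @^-1` A s)) = fine (kappa y (A s)).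
  apply: (ae_forall cG) => g; apply: (ae_forall (countableP _)) => s.
  have mgA := measurable_preimage (bact.2 g) (mA s).
  apply: (@ae_eq_invariant R G d T act m _ _ (kappa_bdd mgA) (kappa_bdd (mA s))).
  - by move=> g' y; rewrite kappa_act.
  - by move=> g' y; rewrite kappa_act.
  - move=> J iJ; rewrite !kappa_cond //; congr fine.
    rewrite -(mp g (measurableI _ _ (mA s) iJ.1)) preimage_setI.
    by rewrite iJ.2.
apply: filterS H => y H g B mB.
apply: (code_measure_unique (m1 := push_measure (kappa y) (bact.2 g))
         (m2 := kappa y) mphi mpsi phiK) => //.
  suff : (kappa y (act g @^-1` setT) < +oo)%E by [].
  by rewrite preimage_setT probability_setT ltry.
move=> s; have mgA := measurable_preimage (bact.2 g) (mA s).
suff : kappa y (act g @^-1` A s) = kappa y (A s) by [].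
by rewrite -[LHS]fineK ?H ?fineK // fin_num_measure.
Qed.

(** By [kappa_avg], this is for almost every [y] the variance of the average under the component of
    [y]. *)
Let dev n s y : R := expect (kappa y) (fun z => (f s n z - h s y) ^+ 2).

Let devE n s y : dev n s y = expect (kappa y) (fun z => f s n z * f s n z)
  - 2 * h s y * expect (kappa y) (f s n) + h s y ^+ 2.
Proof.
have bff := bddM (bf s n) (bf s n).
rewrite -(expectZ (kappa y) _ (bf s n)) -(expectB (kappa y) bff (bddZ _ (bf s n))).
rewrite -[X in _ + X](expect_cst (kappa y)).
rewrite -(expectD (kappa y) (bddB bff (bddZ _ (bf s n))) (bdd_cst T _)).
by apply: eq_expect => z; ring.
Qed.

Let dev_bdd n s : bdd_meas (dev n s).
Proof.
have -> : dev n s = (fun y => (expect (kappa y) (fun z => f s n z * f s n z)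
  - 2 * h s y * expect (kappa y) (f s n)) + h s y * h s y).
  by apply/funext => y; rewrite devE.
apply: bddD; last exact: bddM.
apply: bddB; first by case: (kappa_expect (bddM (bf s n) (bf s n))).
apply: bddM; first exact: bddZ.
by case: (kappa_expect (bf s n)).
Qed.

Let kappa_avg : \forall y \ae m, forall s n, expect (kappa y) (f s n) = h s y.
Proof.
apply: filterS2 kappa_invariant kappa_code => y ky kA s n.
rewrite -kA -[RHS]/(fine (kappa y (A s))) -[A s]setIT.
rewrite -(orbit_avg_expect bact (mA s) ky measurableT _ (avgf s n)) //.
by apply: eq_expect => z; rewrite indicE in_setT mul1r.
Qed.

(** As the mean of [f s n] under [kappa y] is [h s y], the integral of [dev] is that of [f^2 - h^2].
    Values lie in [0, 1], so this is at most [2 |f - h|], and 8 = 2 * 4. *)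
Let dev_expect n s : expect m (dev n s) <= 8 * 4^-1 ^+ n.
Proof.
have bff := bddM (bf s n) (bf s n); have bhh := bddM (bh s) (bh s).
have [bk ek] := kappa_expect bff.
have -> : expect m (dev n s) =
    expect m (fun y => expect (kappa y) (fun z => f s n z * f s n z) - h s y * h s y).
  apply: expect_ae; [exact: dev_bdd|exact: bddB|].
  by apply: filterS kappa_avg => y ky; rewrite devE ky; ring.
rewrite (expectB m bk bhh) ek -(expectB m bff bhh).
apply: (@le_trans _ _ (expect m (fun y => 2 * `|f s n y - h s y|))).
  apply: expect_le; [exact: bddB|by apply: bddZ; exact: bdd_norm (bddB (bf s n) (bh s))|].
  move=> y; have [_ /(_ y) f01] := orbit_avg_unit bact (mA s) (avgf s n).
  have := h01 s y; move: (f s n y) (h s y) f01 => a b a01 b01.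
  have -> : a * a - b * b = (a + b) * (a - b) by ring.
  apply: le_trans (ler_norm _) _; rewrite normrM ler_wpM2r //.
  by rewrite ger0_norm; lra.
rewrite (expectZ m _ (bdd_norm (bddB (bf s n) (bh s)))).
by have := fh s n; move: (expect m _) (_ ^+ n) => E c; lra.
Qed.

(* Averages of [A s] over the group tend to the constant [h s y] in L2([kappa y]), while
   their integral over an invariant set [B] is that of the indicator of [A s]: hence [B]
   is independent of every [A s], and therefore of itself. *)
Lemma kappa_ergodic : \forall y \ae m, ergodic_action (kappa y) act.
Proof.
have H : \forall y \ae m, forall s e, 0 < e -> exists n, dev n s y < e.
  apply: (ae_forall (countableP _)) => s.
  apply: (@ae_small R d T m (fun n => dev n s) 8).
  - by move=> n; exact: dev_bdd.
  - by move=> n y; apply: expect_ge0 => z; exact: sqr_ge0.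
  - by move=> n; exact: dev_expect.
near=> y.
have ky : mp_action (kappa y) act by near: y; exact: kappa_invariant.
have kA : forall s, fine (kappa y (A s)) = h s y by near: y; exact: kappa_code.
have yd : forall s e, 0 < e -> exists n, dev n s y < e by near: y.
move=> B mB iB.
have bB := bdd_indic R mB.
have indep s : fine (kappa y (A s `&` B)) = fine (kappa y (A s)) * fine (kappa y B).
  apply/eqP; rewrite -subr_eq0 -normr_eq0 eq_le normr_ge0 andbT.
  apply/ler_addgt0Pr => e e0; rewrite add0r.
  (* The threshold is [e * e] because [|v| <= v^2 / (2e) + e/2]: a second moment below [e^2] gives a
     mean deviation below [e]. *)
  have [n ne] := yd s _ (mulr_gt0 e0 e0).
  have bfh := bddB (bf s n) (bdd_cst T (h s y)).
  have bsq : bdd_meas (fun z => (f s n z - h s y) ^+ 2) by exact: (bddM bfh bfh).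
  rewrite -(orbit_avg_expect bact (mA s) ky mB iB (avgf s n)) kA.
  have -> : fine (kappa y B) = expect (kappa y) (\1_B : T -> R).
    by rewrite -(expect_indic (kappa y) mB).
  rewrite -(expectZ (kappa y) _ bB) -(expectB (kappa y) (bddM bB (bf s n)) (bddZ _ bB)).
  apply: le_trans (expect_norm _ (bddB (bddM bB (bf s n)) (bddZ _ bB))) _.
  apply: (@le_trans _ _ (expect (kappa y)
      (fun z => (2 * e)^-1 * (f s n z - h s y) ^+ 2 + 2^-1 * e))).
    apply: expect_le; [exact: bdd_norm (bddB (bddM bB (bf s n)) (bddZ _ bB))
      |exact: bddD (bddZ _ bsq) (bdd_cst T _)|].
    move=> z; have -> : \1_B z * f s n z - h s y * \1_B z = \1_B z * (f s n z - h s y).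
      by ring.
    apply: (@le_trans _ _ `|f s n z - h s y|).
      rewrite normrM indicE; case: (_ \in _); rewrite /= ?normr1 ?normr0 ?mul1r ?mul0r //.
    rewrite -real_normK ?num_real //; set v := `|_|.
    rewrite -(ler_pM2l (x := 2 * e)); last lra.
    rewrite mulrDr mulVKf ?gt_eqF //; last lra.
    by have := sqr_ge0 (v - e); rewrite sqrrB; lra.
  rewrite (expectD (kappa y) (bddZ _ bsq) (bdd_cst T _)) (expectZ (kappa y) _ bsq) expect_cst.
  rewrite -/(dev n s y).
  have : (2 * e)^-1 * dev n s y <= (2 * e)^-1 * (e * e).
    by rewrite ler_pM2l ?invr_gt0; lra.
  have -> : (2 * e)^-1 * (e * e) = 2^-1 * e by field; rewrite gt_eqF.
  lra.
pose r : {nonneg R} := NngNum (fine_ge0 (measure_ge0 (kappa y) B)).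
(* As measures in the first set, intersection with [B] and scaling by the measure of [B] agree on
   cylinders, hence also at [B] itself. *)
have kBB : kappa y (B `&` B) = ((fine (kappa y B))%:E * kappa y B)%E.
  apply: (code_measure_unique (m1 := mrestr (kappa y) mB)
         (m2 := mscale r (kappa y)) mphi mpsi phiK) => //.
    suff : (kappa y (setT `&` B) < +oo)%E by [].
    by rewrite setTI -ge0_fin_numE // fin_num_measure.
  move=> s; have mAB := measurableI _ _ (mA s) mB.
  suff : kappa y (A s `&` B) = ((fine (kappa y B))%:E * kappa y (A s))%E by [].
  by rewrite -[LHS]fineK ?indep ?EFinM ?fineK ?(muleC (kappa y B)) // fin_num_measure.
move: kBB; rewrite setIid => kBB.
have : (fine (kappa y B)) * (fine (kappa y B)) = fine (kappa y B).
  by apply: EFin_inj; rewrite EFinM fineK ?fin_num_measure // [RHS]kBB fineK ?fin_num_measure.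
set x := fine _ => xx.
have : x = 0 \/ x = 1.
  have : x * (x - 1) = 0 by rewrite mulrBr xx mulr1 subrr.
  by move=> /eqP; rewrite mulf_eq0 subr_eq0 => /orP[]/eqP; [left|right].
by rewrite -[kappa y B]fineK ?fin_num_measure // -/x => -[] ->; [left|right].
Unshelve. all: by end_near.
Qed.

End Decomposition.

(** The sets where [h] lies below or above its mean are invariant. Neither can have measure 1, since
    a strict inequality almost everywhere contradicts equal integrals. *)
Lemma ergodic_invariant_fun (R : realType) (G : groupType) d (Z : measurableType d)
  (nu : probability Z R) (a : G -> Z -> Z) (h : Z -> R) : ergodic_action nu a ->
  bdd_meas h -> (forall g z, h (a g z) = h z) ->
  \forall z \ae nu, h z = expect nu h.
Proof.
move=> erg bh ih; set c := expect nu h.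
have mlt (u v : Z -> R) : bdd_meas u -> bdd_meas v -> measurable [set z | u z < v z].
  move=> bu bv; rewrite (_ : mkset _ = (fun z => v z - u z) @^-1` `]0, +oo[%classic).
    by apply: (measurable_preimage (bddB bv bu).1); exact: measurable_itv.
  by apply/seteqP; split=> y; rewrite /= in_itv /= andbT subr_gt0.
have bc := bdd_cst Z c.
have key (u v : Z -> R) : bdd_meas u -> bdd_meas v ->
    (forall g z, u (a g z) = u z) -> (forall g z, v (a g z) = v z) ->
    expect nu u = expect nu v -> nu [set z | u z < v z] = 0%E.
  move=> bu bv iu iv uv; have mS := mlt _ _ bu bv.
  case: (erg _ mS) => [g|//|S1].
    by apply/seteqP; split=> z /=; rewrite iu iv.
  have aS : \forall z \ae nu, u z < v z.
    by apply: ae_null => //; rewrite probability_setC // S1 subee.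
  have := ae_of_expect0 (m := nu) bv bu.
  have -> : expect nu (fun z => `|v z - u z|) = expect nu (fun z => v z - u z).
    apply: expect_ae; [exact: bdd_norm (bddB bv bu)|exact: bddB|].
    by apply: filterS aS => z /ltW vu; rewrite ger0_norm // subr_ge0.
  rewrite (expectB nu bv bu) uv subrr => /(_ erefl) vu.
  have [z [uz vz]] : exists z, u z < v z /\ v z = u z.
    by apply: (@ae_exists R d Z nu); exact: filterS2 aS vu.
  by move: uz; rewrite vz ltxx.
have Ec : expect nu (fun=> c) = c by exact: expect_cst.
have h1 := key _ _ bh bc ih (fun _ _ => erefl) (esym Ec).
have h2 := key _ _ bc bh (fun _ _ => erefl) ih Ec.
have m1 := mlt _ _ bh bc; have m2 := mlt _ _ bc bh.
have a1 : \forall z \ae nu, ~ (h z < c).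
  apply: ae_null; first exact: (measurableC m1).
  rewrite (_ : ~` _ = [set z | h z < c]) //.
  by apply/seteqP; split=> z /=; [move/contrapT|move=> ? ?].
have a2 : \forall z \ae nu, ~ (c < h z).
  apply: ae_null; first exact: (measurableC m2).
  rewrite (_ : ~` _ = [set z | c < h z]) //.
  by apply/seteqP; split=> z /=; [move/contrapT|move=> ? ?].
apply: filterS2 a1 a2 => z n1 n2; apply/eqP; rewrite eq_le !leNgt.
by apply/andP; split; apply/negP.
Qed.

Theorem ergodic_decomposition (R : realType) (G : groupType)
  d (T : measurableType d) (act : G -> T -> T) (m : probability T R) :
  countable_group G -> borel_action act -> mp_action m act -> borel_retract T ->
  exists k : T -> probability T R,
    [/\ forall u, bdd_meas u -> bdd_meas (fun y => expect (k y) u) /\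
          expect m (fun y => expect (k y) u) = expect m u,
        \forall y \ae m, mp_action (k y) act &
        \forall y \ae m, ergodic_action (k y) act].
Proof.
move=> cG bact mp [phi [psi [mphi mpsi phiK]]].
have [lam lam_itv] := uniform_itv R.
have /choice[F hF] : forall s, exists F : (nat -> T -> R) * (T -> R),
  [/\ forall n, orbit_avg act (phi @^-1` cylinder s) (F.1 n),
      measurable_fun setT F.2,
      forall y, 0 <= F.2 y <= 1, forall g y, F.2 (act g y) = F.2 y &
      forall n, expect m (fun y => `|F.1 n y - F.2 y|) <= 4 * 4^-1 ^+ n].
  move=> s; have [f [h H]] := mean_ergodic bact
    (measurable_preimage mphi (measurable_cylinder s)) cG mp.
  by exists (f, h).
pose f s := (F s).1; pose h s := (F s).2.
have avgf s n : orbit_avg act (phi @^-1` cylinder s) (f s n).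
  by have [+ _ _ _ _] := hF s; apply.
have mh s : measurable_fun setT (h s) by have [_ + _ _ _] := hF s.
have h01 s y : 0 <= h s y <= 1 by have [_ _ + _ _] := hF s; apply.
have hact s g y : h s (act g y) = h s y by have [_ _ _ + _] := hF s; apply.
have fh s n : expect m (fun y => `|f s n y - h s y|) <= 4 * 4^-1 ^+ n.
  by have [_ _ _ _] := hF s; apply.
exists (kappa m phi mpsi lam mh h01); split.
- exact: (kappa_expect bact mp mphi mpsi phiK lam_itv avgf mh h01 hact fh).
- exact: (kappa_invariant cG bact mp mphi mpsi phiK lam_itv avgf mh h01 hact fh).
- exact: (kappa_ergodic cG bact mp mphi mpsi phiK lam_itv avgf mh h01 hact fh).
Qed.

(** Concrete form of the extreme point argument. Averages of [A s] over the [a]-orbits approach the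
    constant [nu (A s)] in L1, and this persists, along suitable indices, in the image of almost
    every component. That image is [a]-invariant, so the averages also keep its own value on [A s].
    Equivariance of [p] concerns another group than [act], so the last hypothesis records only
    invariance of images. *)
Theorem ergodic_component (R : realType) (G D : groupType)
  d (T : measurableType d) (act : G -> T -> T) (m : probability T R)
  dZ (Z : measurableType dZ) (a : D -> Z -> Z) (nu : probability Z R) (p : T -> Z) :
  countable_group G -> borel_action act -> mp_action m act -> borel_retract T ->
  countable_group D -> borel_action a -> mp_action nu a -> borel_retract Z ->
  ergodic_action nu a -> mp_map m nu p ->
  (forall k : probability T R, mp_action k act -> forall g A, measurable A ->
     k (p @^-1` (a g @^-1` A)) = k (p @^-1` A)) ->
  exists m' : probability T R,
    [/\ mp_action m' act, ergodic_action m' act & mp_map m' nu p].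
Proof.
move=> cG bact mp rT cD ba mpa [phi [psi [mphi mpsi phiK]]] erg [mpp law] ainv.
have [k [kexp kinv kerg]] := ergodic_decomposition cG bact mp rT.
pose A s := phi @^-1` cylinder s.
have mA s : measurable (A s) by exact: (measurable_preimage mphi (measurable_cylinder s)).
(* Ergodicity of [a] makes the limit of the averages constant, and its mean is [nu (A s)]. *)
have dev s : exists f : nat -> Z -> R, (forall n, orbit_avg a (A s) (f n)) /\
    forall n, expect nu (fun z => `|f n z - fine (nu (A s))|) <= 4 * 4^-1 ^+ n.
  have [f [h [avgf mh h01 ha fh]]] := mean_ergodic ba (mA s) cD mpa.
  exists f; split=> // n.
  have bh := bdd_unit mh h01; have bf j := orbit_avg_bdd ba (mA s) (avgf j).
  have Ef j : expect nu (f j) = fine (nu (A s)).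
    rewrite -[A s in RHS]setIT -(orbit_avg_expect ba (mA s) mpa measurableT _ (avgf j)) //.
    by apply: eq_expect => z; rewrite indicE in_setT mul1r.
  have Eh : expect nu h = fine (nu (A s)).
    apply/eqP; rewrite -subr_eq0 -normr_eq0 eq_le normr_ge0 andbT.
    apply/ler_addgt0Pr => e e0; rewrite add0r.
    have [j je] := pow_small (divr_gt0 e0 (ltr0n R 4)).
    rewrite -(Ef j) distrC -(expectB nu (bf j) bh).
    apply: le_trans (expect_norm _ (bddB (bf j) bh)) _.
    by apply: le_trans (fh j) _; lra.
  rewrite (_ : expect nu _ = expect nu (fun z => `|f n z - h z|)) //.
  apply: expect_ae.
  - exact: (bdd_norm (bddB (bf n) (bdd_cst Z _))).
  - exact: (bdd_norm (bddB (bf n) bh)).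
  by apply: filterS (ergodic_invariant_fun erg bh ha) => z ->; rewrite Eh.
have [f /all_and2[avgf fh]] := choice dev.
have bf s n := orbit_avg_bdd ba (mA s) (avgf s n).
have bdev s n := bdd_norm (bddB (bf s n) (bdd_cst Z (fine (nu (A s))))).
have kdev : \forall y \ae m, forall s e, 0 < e ->
    exists n, expect (k y) (fun z => `|f s n (p z) - fine (nu (A s))|) < e.
  apply: (ae_forall (countableP _)) => s.
  apply: (@ae_small R d T m (fun n y =>
    expect (k y) (fun z => `|f s n (p z) - fine (nu (A s))|)) 4).
  - by move=> n; case: (kexp _ (bdd_comp mpp (bdev s n))).
  - by move=> n y; apply: expect_ge0.
  - move=> n; have [_ ->] := kexp _ (bdd_comp mpp (bdev s n)).
    by rewrite (expect_push mpp law (bdev s n)).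
have [y [ky [ey yd]]] : exists y, mp_action (k y) act /\ ergodic_action (k y) act /\
    forall s e, 0 < e ->
      exists n, expect (k y) (fun z => `|f s n (p z) - fine (nu (A s))|) < e.
  apply: (@ae_exists R d T m); apply: filterS2 kinv _ => [y|].
    by move=> h1 h2; split; [exact: h1|exact: h2].
  by apply: filterS2 kerg kdev => y h1 h2; split; [exact: h1|exact: h2].
exists (k y); split=> //; split=> //.
pose q := push_prob (k y) mpp.
have mpq : mp_action q a by move=> g B mB; exact: ainv.
suff H s : q (A s) = nu (A s).
  move=> B mB; apply: (code_measure_unique (m1 := q) (m2 := nu) mphi mpsi phiK) => //.
  suff : (q setT < +oo)%E by [].
  by rewrite probability_setT ltry.
rewrite -[LHS]fineK ?fin_num_measure // -[RHS]fineK ?fin_num_measure //; congr EFin.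
apply/eqP; rewrite -subr_eq0 -normr_eq0 eq_le normr_ge0 andbT.
apply/ler_addgt0Pr => e e0; rewrite add0r.
have [n ne] := yd s e e0.
have Ef : expect q (f s n) = fine (q (A s)).
  rewrite -[A s in RHS]setIT -(orbit_avg_expect ba (mA s) mpq measurableT _ (avgf s n)) //.
  by apply: eq_expect => z; rewrite indicE in_setT mul1r.
rewrite -Ef -[X in _ - X](expect_cst q) -(expectB q (bf s n) (bdd_cst Z _)).
apply: le_trans (expect_norm _ (bddB (bf s n) (bdd_cst Z _))) _.
apply: ltW; apply: le_lt_trans ne.
rewrite le_eqVlt; apply/orP; left; apply/eqP/esym.
by apply: (expect_push (m' := q) mpp _ (bdev s n)).
Qed.

(** * Countable products of Polish metrics *)

Section SupMetric.
Context (R : realType) (T : Type) (rho : nat -> T -> T -> R).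
Hypothesis rho_ge0 : forall n x y, 0 <= rho n x y.
Hypothesis rho_eq0 : forall x y, (forall n, rho n x y = 0) <-> x = y.
Hypothesis rho_sym : forall n x y, rho n x y = rho n y x.
Hypothesis rho_tri : forall n x y z, rho n x z <= rho n x y + rho n y z.
Hypothesis rho_complete : forall u : nat -> T,
  (forall n (e : R), 0 < e -> exists N, forall k l, (N <= k)%N -> (N <= l)%N ->
     rho n (u k) (u l) < e) ->
  exists x, forall n (e : R), 0 < e -> exists N, forall k, (N <= k)%N ->
     rho n (u k) x < e.
Variable D : nat -> T.
Hypothesis rho_dense : forall x (M : nat) (e : R), 0 < e ->
  exists k, forall n, (n < M)%N -> rho n x (D k) < e.

Let cut n x y : R := Num.min n.+1%:R^-1 (rho n x y).

(** The caps [1/(n+1)] leave finitely many coordinates able to exceed a given radius. With a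
    supremum instead of a weighted series, a closed ball is a countable intersection of conditions
    on single coordinates. *)
Definition sup_metric x y : R := sup (range (fun n => cut n x y)).

Let inv_gt0 n : 0 < n.+1%:R^-1 :> R. Proof. by rewrite invr_gt0 ltr0n. Qed.

Let inv_le (m n : nat) : (m <= n)%N -> n.+1%:R^-1 <= m.+1%:R^-1 :> R.
Proof. by move=> mn; rewrite lef_pV2 ?posrE ?ltr0n // ler_nat ltnS. Qed.

Let cut_le n x y : cut n x y <= sup_metric x y.
Proof.
apply: ub_le_sup; last by exists n.
exists 1 => _ [k _ <-]; rewrite /cut ge_min; apply/orP; left.
by rewrite invf_le1 ?ltr0n // ler1n.
Qed.

Let sup_metric_le x y r : (forall n, cut n x y <= r) -> sup_metric x y <= r.
Proof. by move=> h; apply: ge_sup => [|_ [n _ <-]] //; exists (cut 0 x y), 0%N. Qed.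

Let cut_ge0 n x y : 0 <= cut n x y.
Proof. by rewrite /cut le_min rho_ge0 ltW. Qed.

Let cut_tri n x y z : cut n x z <= cut n x y + cut n y z.
Proof.
have := rho_tri n x y z; have := rho_ge0 n x y; have := rho_ge0 n y z.
have := inv_gt0 n; rewrite /cut; move: (n.+1%:R^-1) => b b0.
move: (rho n x z) (rho n x y) (rho n y z) => p q r.
by rewrite /Num.min; case: ifP; case: ifP; case: ifP; lra.
Qed.

Let rho_lt_cut n x y e : cut n x y < Num.min e n.+1%:R^-1 -> rho n x y < e.
Proof.
rewrite /cut lt_min; move: (n.+1%:R^-1) (rho n x y) => b r /andP[].
by rewrite /Num.min; case: ifP => // _; rewrite ?ltxx //.
Qed.

Lemma sup_metric_lt x y M e : M.+1%:R^-1 < e ->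
  (forall n, (n < M)%N -> rho n x y < e) -> sup_metric x y <= e.
Proof.
move=> Me h; apply: sup_metric_le => n; rewrite /cut ge_min.
case: (ltnP n M) => nM; first by rewrite (ltW (h n nM)) orbT.
by rewrite (le_trans (inv_le nM) (ltW Me)).
Qed.

Lemma rho_lt_sup_metric n (e : R) : 0 < e ->
  exists2 r : R, 0 < r & forall x y, sup_metric x y < r -> rho n x y < e.
Proof.
move=> e0; exists (Num.min e n.+1%:R^-1); first by rewrite lt_min e0 inv_gt0.
by move=> x y h; apply: rho_lt_cut; exact: le_lt_trans (cut_le n x y) h.
Qed.

Lemma polish_sup_metric : polish_metric sup_metric.
Proof.
have sym x y : sup_metric x y = sup_metric y x.
  rewrite /sup_metric (_ : (fun n => cut n x y) = (fun n => cut n y x)) //.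
  by apply/funext => n; rewrite /cut rho_sym.
have ge0 x y : 0 <= sup_metric x y by exact: le_trans (cut_ge0 0 x y) (cut_le 0 x y).
have tri x y z : sup_metric x z <= sup_metric x y + sup_metric y z.
  apply: sup_metric_le => n; apply: le_trans (cut_tri n x y z) _.
  exact: lerD (cut_le n x y) (cut_le n y z).
split=> //.
- split=> // x y; split=> [h|<-].
    apply/rho_eq0 => n; apply/eqP; rewrite eq_le rho_ge0 andbT.
    apply/ler_addgt0Pr => e e0; rewrite add0r.
    have [r r0 H] := rho_lt_sup_metric n e0.
    by apply: ltW; apply: H; rewrite h.
  apply/eqP; rewrite eq_le ge0 andbT; apply: sup_metric_le => n.
  by rewrite /cut ((rho_eq0 x x).2 erefl) ge_min lexx orbT.
- move=> u cu; have [|x hx] := rho_complete (u := u).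
    move=> n e e0; have [r r0 H] := rho_lt_sup_metric n e0.
    have [N hN] := cu r r0; exists N => k l Nk Nl; apply: H; exact: hN.
  exists x => e e0.
  have e20 : 0 < e / 2 by rewrite divr_gt0.
  have [M /(_ M (leqnn M)) Me] := small_inv e20.
  have [N hN] : exists N, forall k, (N <= k)%N -> forall n, (n < M)%N ->
      rho n (u k) x < e / 2.
    elim: (M) => [|M' [N hN]]; first by exists 0%N.
    have [N' hN'] := hx M' _ e20; exists (maxn N N') => k.
    rewrite geq_max => /andP[Nk N'k] n; rewrite ltnS leq_eqVlt => /predU1P[->|nM].
      exact: hN'.
    exact: hN.
  exists N => n Nn; apply: (@le_lt_trans _ _ (e / 2)); last lra.
  by apply: (sup_metric_lt Me) => i iM; exact: hN.
- exists D => x e e0; have e20 : 0 < e / 2 by rewrite divr_gt0.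
  have [M /(_ M (leqnn M)) Me] := small_inv e20.
  have [k hk] := rho_dense x M e20.
  exists k; apply: (@le_lt_trans _ _ (e / 2)); last lra.
  exact: (sup_metric_lt Me).
Qed.

(** By separability an open set is a countable union of closed balls, each measurable coordinate by
    coordinate. *)
Lemma measurable_sup_metric_open d (T' : measurableType d) (p : T' -> T) :
  (forall n c r, measurable [set y | rho n (p y) c <= r]) ->
  forall U, metric_open sup_metric U -> measurable (p @^-1` U).
Proof.
move=> mrho U oU.
have [[ge0 eq0] sym tri _ dense] := polish_sup_metric.
have mball c r : measurable [set y | sup_metric (p y) c <= r].
  rewrite (_ : mkset _ = [set y | forall n, cut n (p y) c <= r]).
    apply: measurable_forall => // n.
    case: (leP n.+1%:R^-1 r) => br.
      rewrite (_ : mkset _ = setT) //; apply/seteqP; split=> y //= _.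
      by rewrite /cut ge_min br.
    rewrite (_ : mkset _ = [set y | rho n (p y) c <= r]) //.
    by apply/seteqP; split=> y /=; rewrite /cut ge_min leNgt br.
  apply/seteqP; split=> y /=; last exact: sup_metric_le.
  by move=> h n; exact: le_trans (cut_le n _ _) h.
have [E hE] := dense.
rewrite (_ : _ @^-1` _ = [set y | exists kj : nat * nat,
   (forall z, sup_metric z (E kj.1) <= kj.2.+1%:R^-1 -> U z) /\
   sup_metric (p y) (E kj.1) <= kj.2.+1%:R^-1]).
  apply: measurable_exists => // kj; apply: measurableI; last exact: mball.
  exact: measurable_const.
apply/seteqP; split=> y /=; last by move=> [kj [h]]; exact: h.
move=> Uy; have [r r0 hr] := oU _ Uy.
have r20 : 0 < r / 2 by rewrite divr_gt0.
have [j /(_ j (leqnn j)) jr] := small_inv r20.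
have [k yk] := hE (p y) _ (inv_gt0 j).
exists (k, j) => /=; split; last exact: ltW.
move=> z zk; apply: hr; have := tri (p y) (E k) z; have := sym (E k) z.
by move: jr yk zk; move: (j.+1%:R^-1) => b; lra.
Qed.

End SupMetric.

Lemma standard_borel_prod_seqm (R : realType) dX (X : measurableType dX)
  dZ (Z : measurableType dZ) :
  standard_borel R X -> standard_borel R Z -> standard_borel R (X * seqm Z)%type.
Proof.
move=> [dx [pX mX]] [dz [pZ mZ]].
have [[ge0X eq0X] symX triX compX [DX denseX]] := pX.
have [[ge0Z eq0Z] symZ triZ compZ [DZ denseZ]] := pZ.
pose rho (n : nat) (y y' : X * seqm Z) : R :=
  if n is n'.+1 then dz (y.2 n') (y'.2 n') else dx y.1 y'.1.
(* The default of [nth] extends a finite list to a sequence eventually equal to [DZ 0], which gives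
   a countable dense set. *)
pose D (n : nat) : X * seqm Z :=
  if unpickle n is Some (k, s) then (DX k, fun i => DZ (nth 0%N s i))
  else (DX 0%N, fun=> DZ 0%N).
have rho_ge0 n x y : 0 <= rho n x y by case: n => [|n] /=.
have rho_eq0 x y : (forall n, rho n x y = 0) <-> x = y.
  split=> [|-> [|n] /=]; last 2 first.
  - exact/eq0X.
  - exact/eq0Z.
  case: x y => [x f] [y g] h; congr pair; first exact/eq0X/(h 0%N).
  by apply/funext => n; exact/eq0Z/(h n.+1).
have rho_sym n x y : rho n x y = rho n y x by case: n => [|n] /=.
have rho_tri n x y z : rho n x z <= rho n x y + rho n y z by case: n => [|n] /=.
have rho_complete (u : nat -> X * seqm Z) :
  (forall n (e : R), 0 < e -> exists N, forall k l, (N <= k)%N -> (N <= l)%N ->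
     rho n (u k) (u l) < e) ->
  exists x, forall n (e : R), 0 < e -> exists N, forall k, (N <= k)%N ->
     rho n (u k) x < e.
  move=> cu; have [x hx] := compX (fun n => (u n).1) (cu 0%N).
  have /choice[f hf] : forall i, exists z, forall e : R, 0 < e ->
      exists N, forall n, (N <= n)%N -> dz ((u n).2 i) z < e.
    by move=> i; exact: (compZ (fun n => (u n).2 i) (cu i.+1)).
  by exists (x, f) => -[|n] /=; [exact: hx|exact: hf].
have rho_dense (x : X * seqm Z) (M : nat) (e : R) : 0 < e ->
    exists k, forall n, (n < M)%N -> rho n x (D k) < e.
  move=> e0; have [k hk] := denseX x.1 e e0.
  have /choice[g hg] : forall i, exists j, dz (x.2 i) (DZ j) < e.
    by move=> i; exact: denseZ.
  exists (pickle (k, mkseq g M)) => -[|n] nM; rewrite /rho /D pickleK //=.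
  by rewrite nth_mkseq //; exact: ltnW.
have pS := polish_sup_metric rho_ge0 rho_eq0 rho_sym rho_tri rho_complete rho_dense.
exists (sup_metric rho); split=> // A; split.
- move=> mA.
  suff mid : measurable_fun setT
      (id : g_sigma_algebraType (metric_open (sup_metric rho)) -> X * seqm Z).
    by have := measurable_preimage mid mA.
  have open_coord n (V : Type) (dist : V -> V -> R) (q : X * seqm Z -> V) U :
      (forall y y', dist (q y) (q y') = rho n y y') -> metric_open dist U ->
      metric_open (sup_metric rho) (q @^-1` U).
    move=> qrho oU y Uy; have [r r0 hr] := oU _ Uy.
    have [s s0 hs] := rho_lt_sup_metric rho n r0.
    by exists s => // y' /hs; rewrite -qrho; exact: hr.
  apply/measurable_fun_pairP; split.
    apply: (@measurability _ _ _ _ setT _ (metric_open dx)).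
      by apply/seteqP; split=> B /mX.
    move=> _ [U oU <-]; rewrite setTI; apply: sub_sigma_algebra.
    exact: (open_coord 0%N).
  apply: measurable_seqm => n.
  apply: (@measurability _ _ _ _ setT _ (metric_open dz)).
    by apply/seteqP; split=> B /mZ.
  move=> _ [U oU <-]; rewrite setTI; apply: sub_sigma_algebra.
  exact: (open_coord n.+1 _ _ (fun y => y.2 n)).
- move: A; apply: smallest_sub; first exact: sigma_algebra_measurable.
  move=> U oU.
  apply: (measurable_sup_metric_open rho_ge0 rho_eq0 rho_sym rho_tri rho_complete
    rho_dense (p := id)) => // n c r.
  have mle (V : Type) dV (V' : measurableType dV) (dist : V' -> V' -> R) v :
      polish_metric dist -> (forall B, measurable B <-> <<s metric_open dist >> B) ->
      measurable [set x | dist x v <= r].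
    move=> [_ sym tri _ _] mV.
    rewrite (_ : mkset _ = ~` [set x | r < dist x v]).
      apply: measurableC; apply/mV; apply: sub_sigma_algebra => x /= xr.
      exists (dist x v - r); first by rewrite subr_gt0.
      by move=> y xy; have := tri x y v; lra.
    by apply/seteqP; split=> x /=; rewrite leNgt => /negP.
  case: n => [|n].
    exact: (measurable_preimage measurable_fst (mle unit _ _ _ c.1 pX mX)).
  exact: (measurable_preimage (measurableT_comp (measurable_coord n) measurable_snd)
    (mle unit _ _ _ (c.2 n) pZ mZ)).
Qed.

(** * The co-induced action *)

Lemma group_enum (G : groupType) : countable_group G ->
  exists e : nat -> G, forall g, exists n, e n = g.
Proof.
move=> /countable_injP[f finj].
exists (fun n => if pselect (exists g, f g = n) is left h then sval (cid h) else 1%g).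
move=> g; exists (f g); case: pselect => [h|[]]; last by exists g.
by case: cid => g' /= e; apply: finj; rewrite ?inE.
Qed.

Section Coinduction.
Context (Gamma Delta : groupType) (X Z : Type).
Variables (a0 : Delta -> X -> X) (b0 : Gamma -> X -> X) (a : Delta -> Z -> Z).
Hypotheses (act_a0 : is_action a0) (act_b0 : is_action b0) (act_a : is_action a).
Hypotheses (free_a0 : free_action a0) (free_b0 : free_action b0).
Variable e : nat -> Gamma.
Hypothesis e_surj : forall g, exists n, e n = g.
Local Open Scope group_scope.

Let a0M g h x : a0 g (a0 h x) = a0 (g * h) x. Proof. by rewrite act_a0.2. Qed.
Let b0M g h x : b0 g (b0 h x) = b0 (g * h) x. Proof. by rewrite act_b0.2. Qed.
Let aM g h x : a g (a h x) = a (g * h) x. Proof. by rewrite act_a.2. Qed.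

Lemma free_inj (D : groupType) (T : Type) (t : D -> T -> T) g h x :
  is_action t -> free_action t -> t g x = t h x -> g = h.
Proof.
move=> [t1 tM] ft gh; have /ft : t (h^-1 * g) x = x by rewrite tM gh -tM mulVg t1.
by move=> /(congr1 (mul h)); rewrite mulgA mulgV mul1g mulg1.
Qed.

(** The classes of the orbit are pulled back to [Gamma] through [x]; a change of base point then
    becomes a right translation ([same_class_translate]). *)
Definition same_class (x : X) (g g' : Gamma) : Prop :=
  exists s : Delta, b0 g' x = a0 s (b0 g x).

(** Freeness of [a0] makes this element unique, hence Borel in [x]; the value is 1 across distinct
    classes. *)
Definition class_shift (x : X) (g g' : Gamma) : Delta :=
  if pselect (same_class x g g') is left h then sval (cid h) else 1.

Lemma class_shiftP x g g' s : b0 g' x = a0 s (b0 g x) -> class_shift x g g' = s.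
Proof.
move=> h; rewrite /class_shift; case: pselect => [h'|[]]; last by exists s.
case: cid => s' /= hs'; apply: (free_inj act_a0 free_a0 (x := b0 g x)).
by rewrite -h -hs'.
Qed.

Lemma same_class_refl x g : same_class x g g.
Proof. by exists 1; rewrite act_a0.1. Qed.

Lemma same_class_sym x g g' : same_class x g g' -> same_class x g' g.
Proof. by move=> [s h]; exists s^-1; rewrite h a0M mulVg act_a0.1. Qed.

Lemma same_class_trans x g g' g'' :
  same_class x g g' -> same_class x g' g'' -> same_class x g g''.
Proof. by move=> [s h] [s' h']; exists (s' * s); rewrite h' h a0M. Qed.

Lemma same_class_translate x g g1 g2 :
  same_class (b0 g x) g1 g2 <-> same_class x (g1 * g) (g2 * g).
Proof. by split=> -[s h]; exists s; move: h; rewrite !b0M. Qed.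

Definition class_leader (x : X) (g : Gamma) : nat :=
  odflt 0%N (least (fun k => same_class x (e k) g)).

Lemma class_leaderP x g : same_class x (e (class_leader x g)) g /\
  forall k, (k < class_leader x g)%N -> ~ same_class x (e k) g.
Proof.
rewrite /class_leader; have [|n [-> h1 h2]] := @least_some (fun k => same_class x (e k) g).
  by have [n en] := e_surj g; exists n; rewrite en; exact: same_class_refl.
by split.
Qed.

Lemma class_leader_eq x g g' : same_class x g g' -> class_leader x g = class_leader x g'.
Proof.
move=> h; rewrite /class_leader; congr (odflt _ (least _)).
apply/funext => k; apply/propext; split=> hk; first exact: same_class_trans hk h.
exact: same_class_trans hk (same_class_sym h).
Qed.

Definition is_leader (x : X) (i : nat) : Prop :=
  forall k, (k < i)%N -> ~ same_class x (e k) (e i).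

Lemma class_leader_is_leader x g : is_leader x (class_leader x g).
Proof.
have [h1 h2] := class_leaderP x g; move=> k /h2 hk hk'; apply: hk.
exact: same_class_trans hk' h1.
Qed.

Lemma leader_class_leader x i : is_leader x i -> class_leader x (e i) = i.
Proof.
move=> li; have [h1 h2] := class_leaderP x (e i).
case: (ltngtP (class_leader x (e i)) i) => // [/li|/h2]; first by case.
by case; exact: same_class_refl.
Qed.

(** Counts the leaders below [i], so that the leaders receive consecutive numbers without gaps. *)
Fixpoint rank (x : X) (i : nat) : nat :=
  if i is i'.+1 then (rank x i' + `[< is_leader x i' >])%N else 0%N.

Lemma rank_leader_lt x i j : (i < j)%N -> is_leader x i -> (rank x i < rank x j)%N.
Proof.
move=> + li; elim: j => // j IH; rewrite ltnS leq_eqVlt => /predU1P[<-|/IH h] /=.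
  by rewrite asboolT // addn1.
exact: leq_trans h (leq_addr _ _).
Qed.

Lemma rank_leader_inj x i j : is_leader x i -> is_leader x j ->
  rank x i = rank x j -> i = j.
Proof.
move=> li lj eij; case: (ltngtP i j) => // h.
  by have := rank_leader_lt h li; rewrite eij ltnn.
by have := rank_leader_lt h lj; rewrite eij ltnn.
Qed.

Lemma rank_onto x i n : (n < rank x i)%N -> exists2 j, is_leader x j & rank x j = n.
Proof.
elim: i => [//|i IH] /=; case: asboolP => li; last by rewrite addn0.
by rewrite addn1 ltnS leq_eqVlt => /predU1P[->|//]; exists i.
Qed.

(** Equals [None] exactly when the orbit has at most [n] classes. *)
Definition nth_leader (x : X) (n : nat) : option nat :=
  least (fun i => is_leader x i /\ rank x i = n).

Lemma nth_leaderP x n i :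
  nth_leader x n = Some i <-> is_leader x i /\ rank x i = n.
Proof.
rewrite /nth_leader; split=> [/leastP[]//|[li ri]]; apply/leastP; split=> //.
move=> k ki [lk rk]; move: (ki); suff -> : k = i by rewrite ltnn.
by apply: (@rank_leader_inj x); rewrite ?rk.
Qed.

Definition class_number (x : X) (g : Gamma) : nat := rank x (class_leader x g).

Definition leader_shift (x : X) (g : Gamma) : Delta :=
  class_shift x (e (class_leader x g)) g.

Lemma nth_leader_class x g : nth_leader x (class_number x g) = Some (class_leader x g).
Proof. by apply/nth_leaderP; split=> //; exact: class_leader_is_leader. Qed.

Lemma class_number_inj x g g' : class_number x g = class_number x g' -> same_class x g g'.
Proof.
move=> h; have := nth_leader_class x g; rewrite h nth_leader_class => -[h'].
have [h1 _] := class_leaderP x g; have [h2 _] := class_leaderP x g'.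
by rewrite h' in h2; apply: same_class_trans h2; exact: same_class_sym.
Qed.

Lemma class_number_eq x g g' : same_class x g g' -> class_number x g = class_number x g'.
Proof. by move=> h; rewrite /class_number (class_leader_eq h). Qed.

Lemma leader_shiftP x g : b0 g x = a0 (leader_shift x g) (b0 (e (class_leader x g)) x).
Proof. by have [[s h] _] := class_leaderP x g; rewrite /leader_shift (class_shiftP h). Qed.

Lemma leader_shiftM x g g' s : b0 g' x = a0 s (b0 g x) ->
  leader_shift x g' = s * leader_shift x g.
Proof.
move=> h; have cl : class_leader x g = class_leader x g'.
  by apply: class_leader_eq; exists s.
by apply: class_shiftP; rewrite -cl h {1}(leader_shiftP x g) a0M.
Qed.

Lemma nth_leader_down x n n' i : (n' <= n)%N -> nth_leader x n = Some i ->
  exists j, nth_leader x n' = Some j.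
Proof.
rewrite leq_eqVlt => /predU1P[-> ?|n'n]; first by exists i.
move=> /nth_leaderP[li ri]; rewrite -ri in n'n.
by have [j lj rj] := rank_onto n'n; exists j; apply/nth_leaderP.
Qed.

Lemma leader_translate_inj x g n n' i i' :
  nth_leader (b0 g x) n = Some i -> nth_leader (b0 g x) n' = Some i' ->
  class_number x (e i * g) = class_number x (e i' * g) -> n = n'.
Proof.
move=> /nth_leaderP[li <-] /nth_leaderP[li' <-] /class_number_inj.
move=> /same_class_translate /class_leader_eq.
by rewrite !leader_class_leader // => ->.
Qed.

(** The number of classes does not depend on the base point: [n.+1] classes seen from [b0 g x] would
    inject into the fewer than [n.+1] seen from [x]. *)
Lemma nth_leader_none x g n : nth_leader x n = None -> nth_leader (b0 g x) n = None.
Proof.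
move=> xn; case gn : (nth_leader (b0 g x) n) => [i|] //; exfalso.
have H (k : 'I_n.+1) : exists j, nth_leader (b0 g x) k = Some j.
  by apply: nth_leader_down gn; rewrite -ltnS.
have [j hj] := choice H.
have lt_n (k : 'I_n.+1) : (class_number x (e (j k) * g) < n)%N.
  rewrite ltnNge; apply/negP => nk.
  by have [i' ] := nth_leader_down nk (nth_leader_class x (e (j k) * g)); rewrite xn.
have /leq_card : injective (fun k => Ordinal (lt_n k)).
  move=> k k' [] hk; apply/val_inj => /=.
  exact: leader_translate_inj (hj k) (hj k') hk.
by rewrite !card_ord ltnn.
Qed.

Lemma nth_leader_noneE x g n : nth_leader (b0 g x) n = None <-> nth_leader x n = None.
Proof.
split=> [h|]; last exact: nth_leader_none.
by have := nth_leader_none g^-1 h; rewrite b0M mulVg act_b0.1.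
Qed.

(* The value at [n] of the translated sequence is [a s (f k)], where [(s, k)] is
   [coind_step]; coordinates beyond the number of classes are left unchanged. *)
Definition coind_step (g : Gamma) (x : X) (n : nat) : Delta * nat :=
  if nth_leader (b0 g x) n is Some i then
    (leader_shift x (e i * g), class_number x (e i * g))
  else (1, n).

(** Reindexed coordinates stay below the number of classes, fixed ones lie beyond it, and both base
    points see the same number; so the two kinds never collide. *)
Lemma coind_step_inj g x : injective (fun n => (coind_step g x n).2).
Proof.
move=> n n'; rewrite /coind_step.
case h : (nth_leader (b0 g x) n) => [i|]; case h' : (nth_leader (b0 g x) n') => [i'|] //=.
- exact: leader_translate_inj.
- move=> hn; move/nth_leader_noneE: h'; rewrite -hn nth_leader_class //.
- move=> hn; move/nth_leader_noneE: h; rewrite hn nth_leader_class //.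
Qed.

Definition coind_fiber (g : Gamma) (x : X) (f : nat -> Z) : nat -> Z :=
  fun n => a (coind_step g x n).1 (f (coind_step g x n).2).

Definition coind (g : Gamma) (y : X * (nat -> Z)) : X * (nat -> Z) :=
  (b0 g y.1, coind_fiber g y.1 y.2).

(* A point [(x, f)] encodes a [Delta]-equivariant map from the [Gamma]-orbit of [x]
   to [Z]; [field_at y g] is its value at [g x]. *)
Definition field_at (y : X * (nat -> Z)) (g : Gamma) : Z :=
  a (leader_shift y.1 g) (y.2 (class_number y.1 g)).

Lemma field_at_equiv y g g' s : b0 g' y.1 = a0 s (b0 g y.1) ->
  field_at y g' = a s (field_at y g).
Proof.
move=> h; rewrite /field_at (leader_shiftM h) -aM; congr (a s (a _ (y.2 _))).
by apply/esym/class_number_eq; exists s.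
Qed.

Lemma coind_snd g y n : (coind g y).2 n =
  if nth_leader (b0 g y.1) n is Some i then field_at y (e i * g) else y.2 n.
Proof.
rewrite /= /coind_fiber /coind_step; case: nth_leader => //=.
by rewrite act_a.1.
Qed.

(** In terms of the encoded equivariant map, the action is a right translation of the argument,
    which explains the action laws. *)
Lemma field_at_coind g g' y : field_at (coind g y) g' = field_at y (g' * g).
Proof.
rewrite {1}/field_at coind_snd nth_leader_class.
apply/esym/field_at_equiv; rewrite -!b0M.
exact: leader_shiftP.
Qed.

Lemma coind_action : is_action coind.
Proof.
split=> [[x f]|g h [x f]].
  apply: injective_projections; first exact: act_b0.1.
  apply/funext => n; rewrite coind_snd act_b0.1 /=.
  case E : (nth_leader x n) => [i|] //; move/nth_leaderP: E => [li ri].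
  rewrite mulg1 /field_at /= /leader_shift /class_number leader_class_leader // ri.
  by rewrite (@class_shiftP _ _ _ 1) ?act_a.1 ?act_a0.1.
apply: injective_projections; first exact: act_b0.2.
apply/funext => n; rewrite [RHS]coind_snd coind_snd /= act_b0.2.
case E : (nth_leader (b0 g (b0 h x)) n) => [i|].
  by rewrite (field_at_coind h (e i * g) (x, f)) mulgA.
move/nth_leader_noneE : E => E.
by have := coind_snd h (x, f) n; rewrite /= E.
Qed.

Lemma coind_free : free_action coind.
Proof. by move=> g [x f] [/free_b0]. Qed.

Hypothesis a0_sub : rel_sub (orbit_rel a0) (orbit_rel b0).

(** The cocycle from [Delta] and [X] to [Gamma] attached to the inclusion of orbit relations;
    freeness of [b0] makes it unique. *)
Definition transfer (s : Delta) (x : X) : Gamma :=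
  sval (cid (a0_sub (ex_intro (fun g => a0 s x = a0 g x) s erefl))).

Lemma transferP s x : b0 (transfer s x) x = a0 s x.
Proof. by rewrite /transfer; case: cid => g /= ->. Qed.

Definition coind_sub (s : Delta) (y : X * (nat -> Z)) : X * (nat -> Z) :=
  coind (transfer s y.1) y.

(** The cocycle identity of [transfer], forced by freeness of [b0], combined with the action law of
    [coind]. *)
Lemma coind_sub_action : is_action coind_sub.
Proof.
have [c1 cM] := coind_action.
split=> [y|s t y]; rewrite /coind_sub.
  rewrite (_ : transfer 1 y.1 = 1) ?c1 //.
  by apply: (free_inj act_b0 free_b0 (x := y.1)); rewrite transferP act_a0.1 act_b0.1.
rewrite -cM; congr (coind _ y).
apply: (free_inj act_b0 free_b0 (x := y.1)).
by rewrite transferP -b0M /= !transferP a0M.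
Qed.

Lemma coind_sub_free : free_action coind_sub.
Proof. by move=> s [x f] [] /=; rewrite transferP => /free_a0. Qed.

Lemma coind_sub_orbit : rel_sub (orbit_rel coind_sub) (orbit_rel coind).
Proof. by move=> y _ [s ->]; exists (transfer s y.1). Qed.

Lemma field_at_coind_sub s y : field_at (coind_sub s y) 1 = a s (field_at y 1).
Proof.
rewrite field_at_coind mul1g; apply: field_at_equiv.
by rewrite transferP act_b0.1.
Qed.

End Coinduction.

(** * Measurability of the co-induced action *)

Section CoinductionMeasurable.
Context (Gamma Delta : groupType) dX (X : measurableType dX) dZ (Z : measurableType dZ).
Variables (a0 : Delta -> X -> X) (b0 : Gamma -> X -> X) (a : Delta -> Z -> Z).
Hypotheses (ba0 : borel_action a0) (bb0 : borel_action b0) (ba : borel_action a).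
Hypotheses (free_a0 : free_action a0) (free_b0 : free_action b0).
Hypotheses (cGamma : countable_group Gamma) (cDelta : countable_group Delta).
Variable e : nat -> Gamma.
Hypothesis e_surj : forall g, exists n, e n = g.
Hypothesis rX : borel_retract X.
Local Open Scope group_scope.

Lemma measurable_shift g g' s : measurable [set x | b0 g' x = a0 s (b0 g x)].
Proof.
apply: (measurable_eq rX); first exact: bb0.2.
exact: (measurableT_comp (ba0.2 s) (bb0.2 g)).
Qed.

Lemma measurable_same_class g g' : measurable [set x | same_class a0 b0 x g g'].
Proof. apply: (measurable_exists cDelta) => s; exact: measurable_shift. Qed.

Lemma dmeas_class_shift g g' : dmeas (fun x => class_shift a0 b0 x g g').
Proof.
apply: (dmeas_fibers cDelta) => s.
rewrite (_ : mkset _ = [set x | b0 g' x = a0 s (b0 g x)] `|`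
  (~` [set x | same_class a0 b0 x g g'] `&` [set _ | 1 = s])).
  apply: measurableU; first exact: measurable_shift.
  apply: measurableI; last exact: measurable_const.
  by apply: measurableC; exact: measurable_same_class.
apply/seteqP; split=> x /=.
  case: (pselect (same_class a0 b0 x g g')) => [[s' h]|h].
    by rewrite (class_shiftP ba0.1 free_a0 h) => <-; left.
  by move=> <-; right; split=> //; rewrite /class_shift; case: pselect.
case=> [h|[h <-]]; first exact: (class_shiftP ba0.1 free_a0 h).
by rewrite /class_shift; case: pselect.
Qed.

Lemma dmeas_class_leader g : dmeas (fun x => class_leader a0 b0 e x g).
Proof.
apply: (dmeas_comp (odflt 0%N)); apply: dmeas_least => k.
exact: measurable_same_class.
Qed.

Lemma measurable_is_leader i : measurable [set x | is_leader a0 b0 e x i].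
Proof.
apply: measurable_forall => [//|k]; apply: measurable_imply.
  exact: measurable_const.
exact: (measurableC (measurable_same_class (e k) (e i))).
Qed.

Lemma dmeas_rank i : dmeas (fun x => rank a0 b0 e x i).
Proof.
elim: i => [|i IH] /=; first exact: dmeas_cst.
apply: (@dmeas_bind _ _ nat bool (fun b x => (rank a0 b0 e x i + b)%N)
  (fun x => `[< is_leader a0 b0 e x i >])) => //.
  by apply: dmeas_bool; exact: measurable_is_leader.
by move=> b; exact: (dmeas_comp (fun r => (r + b)%N) IH).
Qed.

Lemma dmeas_class_number g : dmeas (fun x => class_number a0 b0 e x g).
Proof.
exact: (dmeas_bind (countableP _) (dmeas_class_leader g) dmeas_rank).
Qed.

Lemma dmeas_nth_leader n : dmeas (fun x => nth_leader a0 b0 e x n).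
Proof.
apply: dmeas_least => i; apply: measurableI; first exact: measurable_is_leader.
exact: (dmeas_rank i [set n]).
Qed.

Lemma dmeas_leader_shift g : dmeas (fun x => leader_shift a0 b0 e x g).
Proof.
exact: (@dmeas_bind _ _ Delta nat (fun i x => class_shift a0 b0 x (e i) g) _
  (countableP _) (dmeas_class_leader g) (fun i => dmeas_class_shift (e i) g)).
Qed.

Lemma dmeas_leader_data g :
  dmeas (fun x => (leader_shift a0 b0 e x g, class_number a0 b0 e x g)).
Proof.
apply: (@dmeas_bind _ _ (Delta * nat) nat (fun k x => (leader_shift a0 b0 e x g, k))
  _ (countableP _) (dmeas_class_number g)) => k.
exact: (dmeas_comp (fun s => (s, k)) (dmeas_leader_shift g)).
Qed.

Lemma dmeas_coind_step g n : dmeas (fun x => coind_step a0 b0 e g x n).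
Proof.
apply: (@dmeas_bind _ _ (Delta * nat) (option nat) (fun o x => if o is Some i then
   (leader_shift a0 b0 e x (e i * g), class_number a0 b0 e x (e i * g)) else (1, n))
   (fun x => nth_leader a0 b0 e (b0 g x) n)) => //.
  exact: (dmeas_precomp (bb0.2 g) (dmeas_nth_leader n)).
by case=> [i|]; [exact: dmeas_leader_data|exact: dmeas_cst].
Qed.

Lemma countable_shift_index : countable [set: Delta * nat].
Proof.
by rewrite -setXTT; apply: countableX => //; exact: countableP.
Qed.

Lemma measurable_apply (sk : Delta * nat) :
  measurable_fun setT (fun y : X * seqm Z => a sk.1 (y.2 sk.2)).
Proof.
exact: (measurableT_comp (ba.2 sk.1)
  (measurableT_comp (measurable_coord sk.2) measurable_snd)).
Qed.

Lemma measurable_coind g :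
  measurable_fun setT (coind a0 b0 a e g : X * seqm Z -> X * seqm Z).
Proof.
apply/measurable_fun_pairP; split.
  exact: (measurableT_comp (bb0.2 g) measurable_fst).
apply: measurable_seqm => n.
apply: (@measurable_bind _ (X * seqm Z)%type _ Z (Delta * nat)
  (fun sk y => a sk.1 (y.2 sk.2)) (fun y => coind_step a0 b0 e g y.1 n)).
- exact: countable_shift_index.
- exact: (dmeas_precomp measurable_fst (dmeas_coind_step g n)).
- exact: measurable_apply.
Qed.

Lemma measurable_field_at g :
  measurable_fun setT (fun y : X * seqm Z => field_at a0 b0 a e y g).
Proof.
apply: (@measurable_bind _ (X * seqm Z)%type _ Z (Delta * nat)
  (fun sk y => a sk.1 (y.2 sk.2))
  (fun y => (leader_shift a0 b0 e y.1 g, class_number a0 b0 e y.1 g))).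
- exact: countable_shift_index.
- exact: (dmeas_precomp measurable_fst (dmeas_leader_data g)).
- exact: measurable_apply.
Qed.

Hypothesis a0_sub : rel_sub (orbit_rel a0) (orbit_rel b0).

Lemma dmeas_transfer s : dmeas (transfer a0_sub s).
Proof.
apply: (dmeas_fibers cGamma) => g.
rewrite (_ : mkset _ = [set x | b0 g x = a0 s x]).
  by apply: (measurable_eq rX); [exact: bb0.2|exact: ba0.2].
apply/seteqP; split=> x /=; first by move=> <-; exact: transferP.
by rewrite -(transferP a0_sub s) => /(free_inj bb0.1 free_b0).
Qed.

Lemma measurable_coind_sub s :
  measurable_fun setT (coind_sub a e a0_sub s : X * seqm Z -> X * seqm Z).
Proof.
apply: (@measurable_bind _ (X * seqm Z)%type _ (X * seqm Z)%type Gamma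
  (fun g y => coind a0 b0 a e g y) (fun y => transfer a0_sub s y.1)).
- exact: cGamma.
- exact: (dmeas_precomp measurable_fst (dmeas_transfer s)).
- exact: measurable_coind.
Qed.

End CoinductionMeasurable.

(* Invariance under a group passes to every bijection that moves each point by some
   element of the group: split the space according to that element. *)
Lemma full_group_invariant (R : realType) (G : groupType) d (T : measurableType d)
  (c : G -> T -> T) (k : probability T R) (e : nat -> G) (s t : T -> T)
  (u : T -> nat) (B : set T) :
  borel_action c -> mp_action k c -> measurable_fun setT s -> measurable_fun setT t ->
  cancel s t -> cancel t s -> dmeas u -> (forall y, s y = c (e (u y)) y) ->
  measurable B -> k (s @^-1` B) = k B.
Proof.
move=> [[c1 cM] mc] mp ms mt sK tK mu su mB.
have split (v : T -> nat) C : dmeas v -> measurable C ->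
    k C = (\sum_(n <oo) k (C `&` v @^-1` [set n]))%E.
  move=> mv mC; have mCn n : measurable (C `&` v @^-1` [set n]).
    by apply: measurableI => //; exact: mv.
  rewrite -[in LHS](_ : \bigcup_n (C `&` v @^-1` [set n]) = C).
    rewrite measure_bigcup //; first by apply: eq_eseriesl => n; rewrite in_setT.
    by apply/trivIsetP => i j _ _ ij; apply/seteqP; split=> y //= [[_ ->] [_ /eqP]];
      rewrite (negbTE ij).
  by apply/seteqP; split=> [y [n _ []]|y Cy] //; exists (v y).
have mut : dmeas (fun y => u (t y)) by exact: dmeas_precomp mt mu.
(* The source is split by [u], the target by [u] after [t]; the [n]-th source piece is then the
   preimage of the [n]-th target piece under [c (e n)]. *)
rewrite (split u _ mu (measurable_preimage ms mB)) (split _ _ mut mB).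
apply: eq_eseriesr => n _.
have mBn : measurable (B `&` (fun y => u (t y)) @^-1` [set n]).
  by apply: measurableI => //; exact: mut.
rewrite -(mp (e n) _ mBn); congr (k _).
apply/seteqP; split=> y /=.
  by move=> [By <-]; rewrite -su sK.
move=> [By hn].
have : s (t (c (e n) y)) = c (e n) (t (c (e n) y)) by rewrite su hn.
rewrite tK => /(congr1 (c (e n)^-1%g)); rewrite -!cM mulVg !c1 => yt.
by split; [rewrite {1}yt tK|rewrite yt].
Qed.

(** * The invariant measure *)

(** By Fubini: the section of the preimage over [x] has the measure of the section of [B] over
    [t x], and [t] preserves [mu]. *)
Lemma skew_product_invariant (R : realType) d d' (X : measurableType d)
  (W : measurableType d') (mu : probability X R) (P : probability W R)
  (t : X -> X) (s : X -> W -> W) (B : set (X * W)) :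
  measurable_fun setT t ->
  (forall A, measurable A -> mu (t @^-1` A) = mu A) ->
  (forall x A, measurable A -> P (s x @^-1` A) = P A) -> measurable B ->
  (mu \x P)%E ((fun y => (t y.1, s y.1 y.2)) @^-1` B) = (mu \x P)%E B.
Proof.
move=> mt tmu sP mB; pose F := P \o xsection B.
have mF : measurable_fun setT F by exact: measurable_fun_xsection.
transitivity (\int[mu]_x (F \o t) x)%E.
  apply: eq_integral => x _ /=; rewrite /F /=.
  by rewrite -(sP x _ (measurable_xsection (t x) mB)); congr (P _).
transitivity (\int[push_measure mu mt]_x F x)%E.
  have F0 : {in [set: X], forall x, (0 <= F x)%E} by move=> x _; exact: measure_ge0.
  by have := ge0_integral_pushforward mt mu measurableT mF F0; rewrite preimage_setT.
by apply: eq_measure_integral => A mA _; exact: tmu.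
Qed.

Section CoinductionMeasure.
Context (R : realType) (Gamma Delta : groupType).
Context dX (X : measurableType dX) dZ (Z : measurableType dZ).
Variables (mu : probability X R) (nu : probability Z R) (P : probability (seqm Z) R).
Variables (a0 : Delta -> X -> X) (b0 : Gamma -> X -> X) (a : Delta -> Z -> Z).
Hypotheses (ba0 : borel_action a0) (bb0 : borel_action b0) (ba : borel_action a).
Hypotheses (free_a0 : free_action a0) (free_b0 : free_action b0).
Hypotheses (mp_b0 : mp_action mu b0) (mp_a : mp_action nu a).
Variable e : nat -> Gamma.
Hypothesis e_surj : forall g, exists n, e n = g.
Hypothesis Pbox : forall N A, (forall n, measurable (A n)) ->
  P (box N A) = (\prod_(n < N) fine (nu (A n)))%:E.

Lemma coind_mp : mp_action (mu \x P)%E (coind a0 b0 a e : Gamma -> X * seqm Z -> X * seqm Z).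
Proof.
move=> g B mB; apply: (@skew_product_invariant R _ _ X (seqm Z) mu P (b0 g)
  (fun x f => coind_fiber a0 b0 a e g x f)) => //.
- exact: bb0.2.
- exact: mp_b0.
- move=> x A mA; apply: (iid_reindex Pbox (pi := fun n => (coind_step a0 b0 e g x n).2)
    (g := fun n => a (coind_step a0 b0 e g x n).1)) => //.
  + exact: (coind_step_inj ba0.1 bb0.1 e_surj).
  + by move=> n; exact: ba.2.
  + by move=> n C mC; exact: mp_a.
Qed.

(** For fixed [x] the value is a single coordinate, of law [nu], moved by one element of [Delta]. *)
Lemma field_at_law g (A : set Z) : measurable A ->
  (mu \x P)%E ((fun y : X * seqm Z => field_at a0 b0 a e y g) @^-1` A) = nu A.
Proof.
move=> mA.
transitivity (\int[mu]_x (cst (nu A) x))%E; last first.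
  rewrite integral_cst //; transitivity (nu A * 1)%E; last exact: mule1.
  by congr (_ * _)%E; exact: probability_setT.
apply: eq_integral => x _ /=.
rewrite -(mp_a (leader_shift a0 b0 e x g) mA).
rewrite -(iid_coord Pbox (class_number a0 b0 e x g) (measurable_preimage (ba.2 _) mA)).
by congr (P _); apply/seteqP; split=> w; rewrite /xsection /= !inE.
Qed.

End CoinductionMeasure.

Theorem theorem2p1 (R : realType) (Gamma Delta : groupType)
  (hGamma : countable_group Gamma) (hDelta : countable_group Delta)
  (dX : measure_display) (X : measurableType dX) (mu : probability X R)
  (hX : standard_borel R X)
  (a0 : Delta -> X -> X) (b0 : Gamma -> X -> X)
  (ha0 : [/\ borel_action a0, mp_action mu a0 & free_action a0])
  (hb0 : [/\ borel_action b0, mp_action mu b0 & free_action b0])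
  (hb0erg : ergodic_action mu b0)
  (hE0 : rel_sub (orbit_rel a0) (orbit_rel b0))
  (dZ : measure_display) (Z : measurableType dZ) (nu : probability Z R)
  (hZ : standard_borel R Z)
  (a : Delta -> Z -> Z)
  (ha : borel_action a /\ mp_action nu a) :
  exists (dY : measure_display) (Y : measurableType dY) (m : probability Y R)
         (c : Gamma -> Y -> Y) (d : Delta -> Y -> Y) (p : Y -> Z),
    [/\ standard_borel R Y,
        borel_action c /\ borel_action d,
        [/\ free_action c, mp_action m c, free_action d & mp_action m d],
        mp_map m nu p &
        rel_sub (orbit_rel d) (orbit_rel c) /\
        (forall (g : Delta) (y : Y), p (d g y) = a g (p y)) ]
    /\ (ergodic_action nu a -> ergodic_action m c).
Proof.
have [ba0 _ fa0] := ha0; have [bb0 mpb0 fb0] := hb0; have [ba mpa] := ha.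
have rX := standard_borel_retract hX; have rZ := standard_borel_retract hZ.
have sY := standard_borel_prod_seqm hX hZ; have rY := standard_borel_retract sY.
have [e e_surj] := group_enum hGamma.
have [lam lam_itv] := uniform_itv R.
have [P Pbox] := iid_prob lam_itv nu rZ.
pose Y := (X * seqm Z)%type.
pose c : Gamma -> Y -> Y := coind a0 b0 a e.
pose d : Delta -> Y -> Y := coind_sub a e hE0.
pose p (y : Y) := field_at a0 b0 a e y 1%g.
have bc : borel_action c.
  split; first exact: (coind_action ba0.1 bb0.1 ba.1 fa0 e_surj).
  by move=> g; exact: (measurable_coind ba0 bb0 ba fa0 hDelta e rX).
have bd : borel_action d.
  split; first exact: (coind_sub_action ba0.1 bb0.1 ba.1 fa0 fb0 e_surj).
  by move=> s; exact: (measurable_coind_sub ba0 bb0 ba fa0 fb0 hGamma hDelta e rX).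
have mp_p : measurable_fun setT p.
  exact: (measurable_field_at ba0 bb0 ba fa0 hDelta e rX).
have pd s y : p (d s y) = a s (p y).
  exact: (field_at_coind_sub ba0.1 bb0.1 ba.1 fa0 e_surj).
(* Stated for every [c]-invariant measure, since it serves both the ergodic components and the
   measure finally chosen. *)
have sub_mp (k : probability Y R) : mp_action k c -> mp_action k d.
  move=> mpk s B mB.
  have [d1 dM] := bd.1.
  (* The index in the enumeration of the element of [Gamma] by which [d s] moves [y]. *)
  have mt : dmeas (fun y : Y => odflt 0%N (least (fun n => e n = transfer hE0 s y.1))).
    apply: (dmeas_comp (odflt 0%N)); apply: dmeas_least => n.
    exact: (dmeas_precomp measurable_fst
      (dmeas_transfer ba0 bb0 fb0 hGamma rX hE0 s) [set g | e n = g]).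
  apply: (full_group_invariant (e := e) bc mpk (bd.2 s) (bd.2 s^-1%g) _ _ mt _ mB).
  - by move=> y; rewrite -dM mulVg d1.
  - by move=> y; rewrite -dM mulgV d1.
  - move=> y; have [n [h1 h2 _]] := least_some (e_surj (transfer hE0 s y.1)).
    by rewrite h1 /= h2.
pose m0 : probability Y R := (mu \x P)%E.
have mpc0 : mp_action m0 c by exact: (coind_mp ba0 bb0 ba mpb0 mpa e_surj Pbox).
have pm0 : mp_map m0 nu p.
  by split=> // A mA; exact: (field_at_law mu a0 b0 ba mpa e Pbox 1%g mA).
(* The product measure is kept unless [a] is ergodic; in that case an ergodic component with image
   [nu] takes its place. *)
have [m [mpc pm erg]] : exists m : probability Y R,
    [/\ mp_action m c, mp_map m nu p & ergodic_action nu a -> ergodic_action m c].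
  case: (pselect (ergodic_action nu a)) => ea; last by exists m0.
  have [k mpk s A mA|m [h1 h2 h3]] :=
    ergodic_component hGamma bc mpc0 rY hDelta ba mpa rZ ea pm0.
    rewrite -(sub_mp k mpk s _ (measurable_preimage mp_p mA)); congr (k _).
    by apply/seteqP; split=> y; rewrite /= pd.
  by exists m.
exists _, Y, m, c, d, p; split=> //; split=> //.
- split=> //; last exact: sub_mp.
    exact: (coind_free fb0).
  exact: (coind_sub_free fa0).
- split=> //; exact: coind_sub_orbit.
Qed.
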